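(* Let $n\ge3$ and $\beta>0$. There exists a constant $C>0$ such that for any sufficiently large $R$ there is a complete, non-compact $n$-dimensional Riemannian manifold $(M,g)$ and bounded domains $\Omega_1\subset\Omega_2$ of $M$ satisfying $$d_g(x,\partial\Omega_2)=R\quad\text{for each }x\in\partial\Omega_1,$$ with volume ratio $$\frac{\mathrm{Vol}_g(\Omega_2\setminus\Omega_1)}{\mathrm{Vol}_g(\Omega_1)}<Ce^{\beta R}$$ and with scalar curvature satisfying $S_g\le-n(n-1)$ on $M$, for which the first eigenvalue $\lambda$ of the conformal Laplacian $-c_n\Delta_g+S_g$ on $\Omega_2$ satisfies $$\lambda>\begin{cases}\dfrac{1}{(n-1)(n-2)}\beta^2&\text{if }\beta>n-1,\\[2mm]\dfrac{n-1}{n-2}\beta^2-n(n-1)&\text{if }\beta\le n-1.\end{cases}$$ In particular, if $\beta>\sqrt{n(n-2)}$, then $\lambda$ is positive.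
   Context: $S_g$ is the scalar curvature, $c_n=\frac{4(n-1)}{n-2}$, $d_g$ the geodesic distance, $\mathrm{Vol}_g$ the Riemannian volume. The first eigenvalue on $\Omega_2$ is the Dirichlet one, $$\lambda=\inf_{\varphi\in H^1_0(\Omega_2),\ \|\varphi\|_{L^2}=1}\int_{\Omega_2}\left(c_n|\nabla_g\varphi|^2+S_g\varphi^2\right)dV_g .$$ *)

(* Defs.v *)
From HB Require Import structures.
From mathcomp Require Export all_boot all_order all_algebra.
From mathcomp Require Export all_classical all_reals all_analysis.

Set Implicit Arguments.
Unset Strict Implicit.
Unset Printing Implicit Defensive.

Export Order.TTheory GRing.Theory Num.Theory.
Export numFieldNormedType.Exports.

#[global] Open Scope classical_set_scope.
#[global] Open Scope ring_scope.

Section euclidean.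
Context {R : realType} {n : nat}.
Implicit Types (U : set 'rV[R]_n) (f : 'rV[R]_n -> R).

Definition pderiv (k : 'I_n) f : 'rV[R]_n -> R :=
  fun x => 'D_(delta_mx 0 k) f x.

(* C^oo on the open set U: every iterated partial derivative is
   differentiable, hence continuous, at every point of U. *)
Definition smooth_on U f : Prop :=
  forall (s : seq 'I_n) (x : 'rV[R]_n), U x ->
    differentiable (foldr pderiv f s) x.

End euclidean.

(* Iterated one-dimensional Lebesgue integrals; on nonnegative Borel functions
   this is the integral against n-dimensional Lebesgue measure (Tonelli). *)
Fixpoint lebesgue_integral_rV {R : realType} (n : nat) :
    ('rV[R]_n -> \bar R) -> \bar R :=
  match n return ('rV[R]_n -> \bar R) -> \bar R with
  | 0 => fun f => f 0
  | m.+1 => fun f => (\int[lebesgue_measure]_t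
      lebesgue_integral_rV (fun x : 'rV[R]_m =>
        f (row_mx (const_mx t : 'rV[R]_1) x)))%E
  end.

(* Connected smooth n-manifold, presented by a (not necessarily maximal) smooth
   atlas. [coord i] and [coordV i] only matter on [dom i] and on its image;
   [chart_at p] is a chosen chart around [p], used to evaluate
   chart-independent quantities at [p]. *)
Record manifold (R : realType) (n : nat) := Manifold {
  carrier :> ptopologicalType ;
  manifold_hausdorff : hausdorff_space carrier ;
  manifold_second_countable : @second_countable carrier ;
  manifold_connected : connected [set: carrier] ;
  chart : Type ;
  dom : chart -> set carrier ;
  coord : chart -> carrier -> 'rV[R]_n ;
  coordV : chart -> 'rV[R]_n -> carrier ;
  chart_at : carrier -> chart ;
  dom_open : forall i, open (dom i) ;
  codom_open : forall i, open (coord i @` dom i) ;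
  coordK : forall i p, dom i p -> coordV i (coord i p) = p ;
  coord_continuous : forall i p, dom i p -> {for p, continuous (coord i)} ;
  coordV_continuous : forall i x, (coord i @` dom i) x ->
    {for x, continuous (coordV i)} ;
  chart_atP : forall p, dom (chart_at p) p ;
  transition_smooth : forall i j (k : 'I_n),
    smooth_on (coord i @` (dom i `&` dom j))
              (fun x => coord j (coordV i x) 0 k)
}.

Section transition.
Context {R : realType} {n : nat} {M : manifold R n}.

(* Row a, column b: partial derivative in the a-th i-coordinate of the b-th
   j-coordinate ([jacobian] acts on row vectors). *)
Definition transition_jacobian (i j : chart M) (p : M) : 'M[R]_n :=
  jacobian (coord j \o coordV i) (coord i p).

End transition.

(* [g i x] is the matrix of components g_ab at the point with i-coordinates x. *)
Record metric (R : realType) (n : nat) (M : manifold R n) := Metric {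
  metric_mx :> chart M -> 'rV[R]_n -> 'M[R]_n ;
  metric_smooth : forall i (a b : 'I_n),
    smooth_on (coord i @` dom i) (fun x => metric_mx i x a b) ;
  metric_sym : forall i p, dom i p ->
    (metric_mx i (coord i p))^T = metric_mx i (coord i p) ;
  metric_pos : forall i p (v : 'rV[R]_n), dom i p -> v != 0 ->
    0 < (v *m metric_mx i (coord i p) *m v^T) 0 0 ;
  metric_change : forall i j p, dom i p -> dom j p ->
    metric_mx i (coord i p) =
      transition_jacobian i j p *m metric_mx j (coord j p)
        *m (transition_jacobian i j p)^T
}.

Section local_curvature.
Context {R : realType} {n : nat}.
Variable G : 'rV[R]_n -> 'M[R]_n.

(* Gamma^k_ij *)
Definition christoffel (k i j : 'I_n) (x : 'rV[R]_n) : R :=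
  2^-1 * \sum_l invmx (G x) k l *
    (pderiv i (fun y => G y j l) x + pderiv j (fun y => G y i l) x
     - pderiv l (fun y => G y i j) x).

(* R^l_kij, where R(d_i, d_j) d_k = sum_l R^l_kij d_l and
   R(X, Y) = [nabla_X, nabla_Y] - nabla_[X, Y] *)
Definition riemann (l k i j : 'I_n) (x : 'rV[R]_n) : R :=
  pderiv i (christoffel l j k) x - pderiv j (christoffel l i k) x
  + \sum_p (christoffel l i p x * christoffel p j k x
            - christoffel l j p x * christoffel p i k x).

Definition ricci (j k : 'I_n) (x : 'rV[R]_n) : R := \sum_i riemann i k i j x.

Definition scalar (x : 'rV[R]_n) : R :=
  \sum_j \sum_k invmx (G x) j k * ricci j k x.

End local_curvature.

Section riemannian.
Context {R : realType} {n : nat} {M : manifold R n}.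
Variable g : metric M.

Definition scalar_curvature (p : M) : R :=
  scalar (g (chart_at p)) (coord (chart_at p) p).

(* C^1 on a neighbourhood of [0, 1]; this is no restriction, since a C^1 curve
   on the closed interval extends to a slightly larger one. *)
Definition C1_curve (c : R -> M) : Prop :=
  forall t : R, t \in `[0, 1] ->
    {for t, continuous c} /\
    forall i, dom i (c t) ->
      (\forall s \near t, derivable (coord i \o c) s 1) /\
      {for t, continuous (derive1 (coord i \o c))}.

Definition speed (c : R -> M) (t : R) : R :=
  let i := chart_at (c t) in
  let v := derive1 (coord i \o c) t in
  Num.sqrt ((v *m g i (coord i (c t)) *m v^T) 0 0).

Definition curve_length (c : R -> M) : \bar R :=
  (\int[lebesgue_measure]_(t in `[0%R, 1%R]) (speed c t)%:E)%E.

(* A piecewise C^1 curve is a finite chain of C^1 curves. *)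
Fixpoint joins (x : M) (s : seq (R -> M)) (y : M) : Prop :=
  if s is c :: s' then [/\ C1_curve c, c 0 = x & joins (c 1) s' y] else x = y.

Definition geodesic_dist (x y : M) : \bar R :=
  ereal_inf [set (\sum_(c <- s) curve_length c)%E | s in [set s | joins x s y]].

Definition dist_to (x : M) (A : set M) : \bar R :=
  ereal_inf [set geodesic_dist x y | y in A].

Definition complete_metric : Prop :=
  forall u : nat -> M,
    (forall e : R, 0 < e -> exists N : nat, forall k l : nat,
        (N <= k)%N -> (N <= l)%N -> (geodesic_dist (u k) (u l) < e%:E)%E) ->
    exists x : M, (fun k => geodesic_dist (u k) x) @ \oo --> (0 : \bar R)%E.

Definition domain (A : set M) : Prop := [/\ A !=set0, open A & connected A].

Definition metric_bounded (A : set M) : Prop :=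
  exists r : R, forall x y, A x -> A y -> (geodesic_dist x y <= r%:E)%E.

Definition boundary (A : set M) : set M := closure A `\` interior A.

Definition borel : measurableType _ := g_sigma_algebraType (@open M).

(* This determines [vol]: M is covered by countably many chart domains. *)
Definition riemannian_volume (vol : {measure set borel -> \bar R}) : Prop :=
  forall i (A : set borel), measurable A -> A `<=` dom i ->
    vol A = lebesgue_integral_rV (fun x =>
      (\1_(coord i @` A) x * Num.sqrt (\det (g i x)))%:E).

(* A 1-form, given by its components in every chart. *)
Definition covector_field (w : chart M -> M -> 'rV[R]_n) : Prop :=
  forall i j p, dom i p -> dom j p ->
    w i p = w j p *m (transition_jacobian i j p)^T.

Definition measurable_covector_field (w : chart M -> M -> 'rV[R]_n) : Prop :=
  covector_field w /\
  forall i (k : 'I_n),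
    measurable_fun (dom i : set borel) (fun p : borel => w i p 0 k).

Definition differential (phi : M -> R) : chart M -> M -> 'rV[R]_n :=
  fun i p => \row_k pderiv k (phi \o coordV i) (coord i p).

Definition covector_norm2 (w : chart M -> M -> 'rV[R]_n) (p : M) : R :=
  let i := chart_at p in
  (w i p *m invmx (g i (coord i p)) *m (w i p)^T) 0 0.

(* C^oo_c(A) *)
Definition test_function (A : set M) (phi : M -> R) : Prop :=
  (forall i, smooth_on (coord i @` dom i) (phi \o coordV i)) /\
  (exists K : set M, [/\ compact K, K `<=` A &
                         forall p, ~ K p -> phi p = 0]).

Variable vol : {measure set borel -> \bar R}.

(* [phi] belongs to H^1_0(A), the closure of C^oo_c(A) in the H^1 norm, and [w]
   is its weak differential on A, the L^2 limit of the differentials of the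
   approximating test functions; |w|_g is the norm of the weak gradient. *)
Definition H10 (A : set M) (phi : M -> R) (w : chart M -> M -> 'rV[R]_n) :
    Prop :=
  [/\ measurable_fun (A : set borel) (phi : borel -> R),
      measurable_covector_field w &
      exists f : nat -> M -> R,
        [/\ forall k, test_function A (f k),
            (\int[vol]_(p in (A : set borel)) ((f k p - phi p) ^+ 2)%:E)%E
              @[k --> \oo] --> (0 : \bar R)%E &
            (\int[vol]_(p in (A : set borel))
               (covector_norm2
                  (fun i q => differential (f k) i q - w i q) p)%:E)%E
              @[k --> \oo] --> (0 : \bar R)%E]].

Definition conformal_constant : R := 4 * (n%:R - 1) / (n%:R - 2).

Definition conformal_energy (A : set M) (phi : M -> R)
    (w : chart M -> M -> 'rV[R]_n) : \bar R :=
  (\int[vol]_(p in (A : set borel))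
     (conformal_constant * covector_norm2 w p
      + scalar_curvature p * phi p ^+ 2)%:E)%E.

Definition first_eigenvalue (A : set M) : \bar R :=
  ereal_inf [set e | exists phi w,
    [/\ H10 A phi w,
        (\int[vol]_(p in (A : set borel)) (phi p ^+ 2)%:E = 1)%E &
        e = conformal_energy A phi w]].

End riemannian.

Arguments borel {R n} M.

(* Main.v *)
(* M is R^n with one global chart (t, x_1, ..., x_{n-1}) and the metric
     g = dt^2 + sum_j e^{2 a_j t} dx_j^2,   sum_j a_j = beta,
   a left-invariant metric on a solvable group. Its scalar curvature is the constant
   -(beta^2 + sum_j a_j^2), its volume density is e^{beta t}. Taking all the a_j equal to
   beta/(n-1) gives -n beta^2/(n-1), which is at most -n(n-1) when beta >= n-1; when
   beta < n-1, moving two of the a_j apart increases sum_j a_j^2 until the scalar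
   curvature is -n(n-1).

   Every t-line contributes a weighted Hardy inequality
     int (u')^2 e^{beta t} >= (beta^2/4 + delta) int u^2 e^{beta t}
   for u supported in |t| <= p, with some delta(p) > 0, whence
   lambda >= c_n (beta^2/4 + delta) - (beta^2 + sum_j a_j^2), which exceeds the required
   bound because c_n/4 = (n-1)/(n-2).

   Omega_2 is the box |t| < r+2, |x_j| < rho, and Omega_1 is a connected component of the
   set of points of Omega_2 at distance more than r from the boundary of Omega_2; by
   continuity of the distance, that distance equals r on the boundary of Omega_1. With rho
   exponentially large in r, Omega_1 contains the box |t| < 1, |x_j| < rho/2, so the volume
   ratio is of order e^{beta r}. *)
From HB Require Import structures.
Require Import Defs.
From mathcomp Require Import measurable_realfun ring lra.

Set Implicit Arguments.
Unset Strict Implicit.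
Unset Printing Implicit Defensive.

(** * The metric and its scalar curvature *)

(** The volume density depends on [t] alone, so every box has volume equal to a [t]-integral times
    its cross-section. The cross-section of the outer box and that of a box of half its width differ
    by the factor [2 ^+ (n - 1)] only; hence the width may be taken exponentially large in [r]
    without harming a constant [C] independent of [r], and the walls in the [x_j] directions can be
    pushed so far away that only the walls in the [t] direction are within reach.

    No distance is computed exactly. A curve of length [l] changes [t] by at most [l], because the
    coefficient of [dt^2] is 1; it then stays in a slab where all other coefficients are bounded
    below by an explicit exponential, which bounds the displacement of the [x_j]. Straight segments
    give the opposite estimate.

    The gain [delta] serves two purposes: the required eigenvalue bound is strict, and a constant
    slightly below the Hardy constant survives the passage from test functions to [H^1_0]. In the
    isotropic case the bound comes from [(n-1)/(n-2) - n/(n-1) = 1/((n-1)(n-2))], that is,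
    [(n-1)^2 - n(n-2) = 1]. *)

Lemma sumr_single (V : nmodType) (I : finType) (F : I -> V) (k : I) :
  (forall i, i != k -> F i = 0) -> \sum_i F i = F k.
Proof. by move=> F0; rewrite (bigD1 k)//= big1 ?addr0// => i /F0. Qed.

Section line_derivative.
Context {R : realType} {V W : normedModType R}.

(** Turns directional derivatives into one-variable calculus: used for partial derivatives, for the
    velocity of a segment and on the [t]-lines of the Hardy inequality. *)
Lemma is_derive_line (f : V -> W) (x v : V) (t : R) :
  derivable f (x + t *: v) v ->
  is_derive t 1 (fun s : R => f (x + s *: v)) ('D_v f (x + t *: v)).
Proof.
have E : (fun h : R => h^-1 *: (f (h *: v + (x + t *: v)) - f (x + t *: v))) =
         (fun h : R => h^-1 *: (f (x + (h *: 1 + t) *: v) - f (x + t *: v))).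
  by apply/funext => h; rewrite [h *: 1]mulr1 scalerDl addrCA.
move=> fv; split; first by move: fv; rewrite /derivable E.
by rewrite /derive E.
Qed.

End line_derivative.

Lemma is_derive_expR_affine {R : realType} (c b d t : R) :
  is_derive t 1 (fun s : R => c * expR (b + d * s)) (c * d * expR (b + d * t)).
Proof.
have h : is_derive t 1 (cst b + d \*: id) d.
  by apply: is_derive_eq; rewrite add0r [LHS]mulr1.
have := is_deriveZ c (is_derive1_comp (is_derive_expR ((cst b + d \*: id) t)) h).
move=> /is_derive_eq; apply.
by rewrite [LHS]mulrA mulrAC.
Qed.

Section smooth.
Context {R : realType} {m : nat}.
Implicit Types (x : 'rV[R]_m.+1).

(** A family closed under all partial derivatives, so smoothness follows by induction on the list of
    indices. It contains the metric coefficients, their inverses, the volume density and, for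
    [b = 0], the constants. *)
Definition expt (c b : R) x : R := c * expR (b * x 0 0).

Lemma differentiable_expt c b x : differentiable (expt c b) x.
Proof.
apply: differentiableZ.
apply: (@differentiable_comp _ _ _ _ (fun x : 'rV[R]_m.+1 => b * x 0 0) expR).
  by apply: differentiableZ; exact: differentiable_coord.
by apply/derivable1_diffP; exact: derivable_expR.
Qed.

Lemma pderiv_expt c b (k : 'I_m.+1) :
  pderiv k (expt c b) = expt (c * (b *+ (k == 0))) b.
Proof.
apply/funext => x; rewrite /pderiv.
have /is_derive_line : derivable (expt c b) (x + 0 *: delta_mx 0 k) (delta_mx 0 k).
  exact/diff_derivable/differentiable_expt.
rewrite scale0r addr0 => -[_ <-].
have -> : (fun s : R => expt c b (x + s *: delta_mx 0 k)) =
   (fun s => c * expR (b * x 0 0 + (b *+ (k == 0)) * s)).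
  apply/funext => s; rewrite /expt !mxE eqxx/= eq_sym.
  by case: (k == 0) => /=; rewrite ?mulr1n ?mulr0n; congr (_ * expR _); ring.
by rewrite (@derive_val _ _ _ _ _ _ _ (is_derive_expR_affine _ _ _ _)) mulr0 addr0.
Qed.

Lemma smooth_on_expt U c b : smooth_on U (expt c b).
Proof.
move=> s x _.
suff [c' ->] : exists c', foldr pderiv (expt c b) s = expt c' b.
  exact: differentiable_expt.
elim: s => [|k s [c' IHs]]; first by exists c.
by exists (c' * (b *+ (k == 0))); rewrite /= IHs pderiv_expt.
Qed.

Lemma smooth_on_coord U (k : 'I_m.+1) : smooth_on U (fun x : 'rV[R]_m.+1 => x 0 k).
Proof.
(* The last index of the list is the innermost derivative; it turns the coordinate into a constant,
   which is [expt] with exponent 0. *)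
move=> s x _; case/lastP: s => [|s j]; first exact: differentiable_coord.
rewrite foldr_rcons.
suff -> : pderiv j (fun x : 'rV[R]_m.+1 => x 0 k) = expt (j == k)%:R 0.
  exact: smooth_on_expt.
apply/funext => y; rewrite /pderiv /expt mul0r expR0 mulr1.
have /is_derive_line : derivable (fun x : 'rV[R]_m.+1 => x 0 k)
    (y + 0 *: delta_mx 0 j) (delta_mx 0 j).
  exact/diff_derivable/differentiable_coord.
rewrite scale0r addr0 => -[_ <-].
have -> : (fun s : R => (y + s *: delta_mx 0 j) 0 k) = cst (y 0 k) + (j == k)%:R \*: id.
  by apply/funext => t; rewrite !mxE eqxx/= eq_sym mulrC.
have h : is_derive (0 : R) 1 (cst (y 0 k) + (j == k)%:R \*: id) (j == k)%:R.
  by apply: is_derive_eq; rewrite add0r [LHS]mulr1.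
exact: derive_val.
Qed.

End smooth.

Section curvature.
Context {R : realType} {m : nat}.
Variable a : 'I_m.+1 -> R.
Implicit Types (x : 'rV[R]_m.+1).

(** Index 0 is the coordinate [t]. The hypothesis [a 0 = 0] makes its coefficient 1 and lets one
    formula cover all diagonal entries. *)
Definition warp (j : 'I_m.+1) x : R := expR (2 * a j * x 0 0).

Definition solv_mx x : 'M[R]_m.+1 := diag_mx (\row_j warp j x).

Lemma warpE j : warp j = expt 1 (2 * a j).
Proof. by apply/funext => x; rewrite /expt mul1r. Qed.

Lemma warp_gt0 j x : 0 < warp j x. Proof. exact: expR_gt0. Qed.

Lemma solv_mxE i j x : solv_mx x i j = warp i x *+ (i == j).
Proof. by rewrite !mxE. Qed.

Lemma smooth_on_solv_mx U i j : smooth_on U (fun x => solv_mx x i j).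
Proof.
have -> : (fun x => solv_mx x i j) = expt (i == j)%:R (2 * a i).
  by apply/funext => x; rewrite solv_mxE /expt mulr_natl.
exact: smooth_on_expt.
Qed.

Lemma invmx_solv_mx x : invmx (solv_mx x) = diag_mx (\row_j (warp j x)^-1).
Proof.
have h1 : diag_mx (\row_j (warp j x)^-1) *m solv_mx x = 1%:M.
  rewrite mulmx_diag; apply/matrixP => i j; rewrite !mxE mulVf//.
  exact/lt0r_neq0/warp_gt0.
have [_ u] := mulmx1_unit h1.
by rewrite -[RHS]mulmx1 -(mulmxV u) mulmxA h1 mul1mx.
Qed.

Lemma quad_solv_mx x (v : 'rV[R]_m.+1) :
  (v *m solv_mx x *m v^T) 0 0 = \sum_j warp j x * v 0 j ^+ 2.
Proof.
rewrite mul_mx_diag !mxE; apply: eq_bigr => j _; rewrite !mxE; ring.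
Qed.

Lemma quad_invmx_solv_mx x (v : 'rV[R]_m.+1) :
  (v *m invmx (solv_mx x) *m v^T) 0 0 = \sum_j (warp j x)^-1 * v 0 j ^+ 2.
Proof.
rewrite invmx_solv_mx mul_mx_diag !mxE; apply: eq_bigr => j _; rewrite !mxE; ring.
Qed.

Hypothesis a0 : a 0 = 0.

Lemma warp0 x : warp 0 x = 1. Proof. by rewrite /warp a0 mulr0 mul0r expR0. Qed.

Lemma pderiv_solv_mx k i j :
  pderiv k (fun x => solv_mx x i j) = fun x => 2 * a i * warp i x *+ ((k == 0) && (i == j)).
Proof.
have -> : (fun x => solv_mx x i j) = expt (i == j)%:R (2 * a i).
  by apply/funext => x; rewrite solv_mxE /expt mulr_natl.
rewrite pderiv_expt; apply/funext => x; rewrite /expt -/(warp i x).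
by case: (k == 0); case: (i == j); rewrite ?mulr1n ?mulr0n /=; ring.
Qed.

(** The surviving symbols are [Gamma^k_0k = Gamma^k_k0 = a_k] and [Gamma^0_ii = - a_i e^{2 a_i t}];
    the overlap of the three terms at [i = j = k = 0] is harmless because [a 0 = 0]. *)
Lemma christoffel_solv k i j : christoffel solv_mx k i j =
  fun x => a k *+ ((i == 0) && (j == k)) + a k *+ ((j == 0) && (i == k))
           - a i * warp i x *+ ((k == 0) && (i == j)).
Proof.
apply/funext => x; rewrite /christoffel (bigD1 k)//= big1 => [|l lk]; last first.
  by rewrite invmx_solv_mx !mxE eq_sym (negbTE lk) mul0r.
rewrite addr0 !pderiv_solv_mx invmx_solv_mx !mxE eqxx mulr1n.
have -> : 2 * a j * warp j x *+ ((i == 0) && (j == k)) =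
          2 * a k * warp k x *+ ((i == 0) && (j == k)).
  by have [->|] := eqVneq j k; rewrite ?andbF.
have -> : 2 * a i * warp i x *+ ((j == 0) && (i == k)) =
          2 * a k * warp k x *+ ((j == 0) && (i == k)).
  by have [->|] := eqVneq i k; rewrite ?andbF.
have : (warp k x)^-1 * warp k x = 1 by rewrite mulVf// lt0r_neq0// warp_gt0.
have : (k == 0) -> (warp k x)^-1 = 1 by move=> /eqP ->; rewrite warp0 invr1.
move: (warp k x) (warp k x)^-1 => w u u1 wu.
have half (r : R) : 2^-1 * (2 * r) = r by field.
transitivity (a k * (u * w) *+ ((i == 0) && (j == k)) + a k * (u * w) *+ ((j == 0) && (i == k))
   - a i * warp i x * u *+ ((k == 0) && (i == j))).
  rewrite -[RHS]half; congr (_ * _).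
  by case: (_ && _); case: (_ && _); case: (_ && _); rewrite ?mulr1n ?mulr0n; ring.
rewrite wu !mulr1; congr (_ - _).
by case: (k == 0) u1 => //= ->; rewrite ?mulr1.
Qed.

Lemma pderiv_christoffel_solv l k i j : pderiv l (christoffel solv_mx k i j) =
  fun x => - (2 * a i ^+ 2 * warp i x) *+ [&& l == 0, k == 0 & i == j].
Proof.
pose C : R := a k *+ ((i == 0) && (j == k)) + a k *+ ((j == 0) && (i == k)).
pose c : R := a i *+ ((k == 0) && (i == j)).
have -> : christoffel solv_mx k i j = cst C - expt c (2 * a i).
  rewrite christoffel_solv; apply/funext => x.
  by rewrite /expt /c -mulrnAl.
apply/funext => x; rewrite /pderiv deriveB; last 2 first.
- exact: derivable_cst.
- exact/diff_derivable/differentiable_expt.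
rewrite derive_cst sub0r -[X in - X]/(pderiv l _ x) pderiv_expt /expt -/(warp i x) /c.
by case: (l == 0); case: (k == 0); case: (i == j); rewrite /= ?mulr1n ?mulr0n; ring.
Qed.

End curvature.

Section scalar_curvature.
Context {R : realType} {m : nat}.
Variable a : 'I_m.+1 -> R.
Implicit Types (x : 'rV[R]_m.+1).
Hypothesis a0 : a 0 = 0.
Local Notation warp := (warp a).
Local Notation solv_mx := (solv_mx a).

Lemma exponent_eq0 i b : a i *+ ((i == 0) && b) = 0.
Proof. by have [->|] := eqVneq i 0; rewrite ?a0 ?mul0rn. Qed.

(** Diagonal entries suffice, the inverse metric being diagonal. [T1] and [T2] are the derivative
    terms, [T3] and [T4] the quadratic ones; the terms [2 a_j^2 e^{2 a_j t}] of [T1] and [T4]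
    cancel. *)
Lemma ricci_solv j x : ricci solv_mx j j x =
  - (\sum_i a i) * a j * warp j x - (\sum_i a i ^+ 2) *+ (j == 0).
Proof.
rewrite /ricci /riemann !big_split/= sumrN.
have T1 : \sum_i pderiv i (christoffel solv_mx i j j) x = - (2 * a j ^+ 2 * warp j x).
  rewrite (@sumr_single _ _ _ 0) => [|i /negbTE ni0]; rewrite (pderiv_christoffel_solv a0) ?eqxx//.
  by rewrite ni0 mulr0n.
have T2 : \sum_i pderiv j (christoffel solv_mx i i j) x = 0.
  rewrite big1// => i _; rewrite (pderiv_christoffel_solv a0).
  by have [->|] := eqVneq i 0; rewrite ?andbF// a0 expr0n/= mulr0 mul0r oppr0 mul0rn.
have G i p : christoffel solv_mx i i p x = a i *+ (p == 0).
  rewrite (christoffel_solv a0) exponent_eq0 add0r eqxx andbT.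
  by have [->|_] := eqVneq i 0; rewrite ?a0 ?mul0r ?mul0rn subr0.
have T3 : \sum_i \sum_p christoffel solv_mx i i p x * christoffel solv_mx p j j x
    = - (\sum_i a i) * a j * warp j x.
  transitivity (\sum_i a i * - (a j * warp j x)); last by rewrite -mulr_suml; ring.
  apply: eq_bigr => i _; rewrite (@sumr_single _ _ _ 0) => [|p /negbTE p0]; last first.
    by rewrite G p0 mulr0n mul0r.
  rewrite G eqxx mulr1n (christoffel_solv a0) [0 == 0]eqxx [j == j]eqxx a0 /= !mul0rn.
  by rewrite !add0r mulr1n.
have T4 : \sum_i \sum_p christoffel solv_mx i j p x * christoffel solv_mx p i j x
    = (\sum_i a i ^+ 2) *+ (j == 0) - 2 * a j ^+ 2 * warp j x.
  have [->|j0] := eqVneq j 0.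
    rewrite a0 expr0n/= mulr0 mul0r subr0; apply: eq_bigr => i _.
    rewrite (@sumr_single _ _ _ i) => [|p /negbTE pi]; rewrite !(christoffel_solv a0) !eqxx/=.
      have [->|i0] := eqVneq i 0; first by rewrite a0; ring.
      by rewrite /= ?mulr0n ?mulr1n ?a0; ring.
    rewrite pi [0 == p]eq_sym [0 == i]eq_sym ?exponent_eq0.
    have [->|_] := eqVneq i 0; first by rewrite ?pi ?andbF ?a0; ring.
    by rewrite ?andbF /= ?mulr0n ?a0; ring.
  have nj0 := negbTE j0.
  (* For [j != 0] only the pairs [(i, p) = (j, 0)] and [(0, j)] contribute, each with the same
     product. *)
  transitivity (\sum_i ((- a j ^+ 2 * warp j x) *+ (i == j) +
    (- a j ^+ 2 * warp j x) *+ (i == 0))); last first.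
    rewrite big_split/= (@sumr_single _ _ _ j) => [|i /negbTE ->]; last by rewrite mulr0n.
    rewrite [X in _ + X](@sumr_single _ _ _ 0) => [|i /negbTE ->]; last by rewrite mulr0n.
    by rewrite !eqxx !mulr1n mulr0n; ring.
  apply: eq_bigr => i _.
  have [->|ij] := eqVneq i j.
    rewrite (@sumr_single _ _ _ 0) => [|p /negbTE p0]; rewrite !(christoffel_solv a0) nj0 ?eqxx/=.
      by rewrite ?mulr1n ?mulr0n; ring.
    by rewrite p0 ?mulr0n; ring.
  have [->|i0] := eqVneq i 0.
    rewrite (@sumr_single _ _ _ j) => [|p /negbTE pj]; rewrite !(christoffel_solv a0) nj0 ?eqxx/=.
      by rewrite ?[0 == j]eq_sym ?nj0 ?andbF /= ?mulr1n ?mulr0n; ring.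
    by rewrite ?[j == p]eq_sym ?[0 == j]eq_sym ?pj ?nj0 ?andbF /= ?mulr0n; ring.
  rewrite big1 => [|p _]; first by rewrite !mulr0n addr0.
  rewrite !(christoffel_solv a0) nj0 (negbTE i0) (negbTE ij) [j == i]eq_sym (negbTE ij).
  rewrite !andbF /= !mulr0n.
  by ring.
under [X in _ + X]eq_bigr => i _ do rewrite sumrB.
by rewrite sumrB T1 T2 T3 T4; ring.
Qed.

Lemma scalar_solv x :
  scalar solv_mx x = - ((\sum_i a i) ^+ 2 + \sum_i a i ^+ 2).
Proof.
transitivity (\sum_j (warp j x)^-1 * ricci solv_mx j j x).
  apply: eq_bigr => j _; rewrite (@sumr_single _ _ _ j) => [|k kj].
    by rewrite invmx_solv_mx !mxE eqxx mulr1n.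
  by rewrite invmx_solv_mx !mxE eq_sym (negbTE kj) mul0r.
transitivity (\sum_j (- (\sum_i a i) * a j - (\sum_i a i ^+ 2) *+ (j == 0))).
  apply: eq_bigr => j _; rewrite ricci_solv.
  have w0 : warp j x != 0 by rewrite lt0r_neq0// warp_gt0.
  have [->|] := eqVneq j 0; last by rewrite !mulr0n !subr0 => _; field.
  by rewrite warp0// invr1 !mul1r mulr1.
rewrite sumrB -mulr_sumr [X in _ - X](@sumr_single _ _ _ 0) => [|i /negbTE ->//].
by rewrite eqxx mulr1n; ring.
Qed.

End scalar_curvature.

(** * Topology of row vectors *)

Section rV_topology.
Context {R : realType} {n : nat}.

(** A countable base of balls. It gives second countability here, and later reduces the
    measurability of [rV_cons] to products of balls. *)
Definition rat_ball (q : 'rV[rat]_n * nat) : set 'rV[R]_n :=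
  ball (map_mx ratr q.1 : 'rV[R]_n) q.2.+1%:R^-1.

Lemma open_rat_ball (U : set 'rV[R]_n) (x : 'rV[R]_n) : open U -> U x ->
  exists q, rat_ball q x /\ rat_ball q `<=` U.
Proof.
move=> oU Ux; have /nbhs_ballP[e /= e0 eU] : nbhs x U by exact: open_nbhs_nbhs.
have e2 : 0 < e / 2 by rewrite divr_gt0.
have [N ltN] : exists N : nat, N.+1%:R^-1 < e / 2.
  by have [N _ /(_ N (leqnn N)) H] := near_infty_natSinv_lt (PosNum e2); exists N.
have : 0 < N.+1%:R^-1 :> R by rewrite invr_gt0.
move dE : (N.+1%:R^-1) ltN => d ltN d0.
have /choice[q qx] : forall j, exists q : rat, ratr q \in `]x 0 j - d, x 0 j + d[.
  by move=> j; apply: rat_in_itvoo; lra.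
exists (\row_j q j, N); rewrite /rat_ball /= dE.
have bq : ball (map_mx ratr (\row_j q j) : 'rV[R]_n) d x.
  split=> // i j; rewrite !mxE ord1; have := qx j; rewrite in_itv/= /ball/= ltr_norml.
  by move=> ?; apply/andP; split; lra.
split=> // y qy; apply: eU; rewrite [e]splitr.
apply: ball_triangle; first by apply: ball_sym; apply: le_ball bq; exact: ltW.
by apply: le_ball qy; exact: ltW.
Qed.

Lemma rV_second_countable : @second_countable 'rV[R]_n.
Proof.
exists (range rat_ball).
  exact: sub_countable (card_image_le _ _) (countableP _).
split.
- by move=> _ [q _ <-]; exact: ball_open.
- move=> x U; rewrite nbhsE => -[V [oV Vx] VU].
  have [q [qx qV]] := open_rat_ball oV Vx.
  by exists (rat_ball q); [split=> //; exists q|apply: subset_trans VU].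
Qed.

Lemma continuous_coord (j : 'I_n) : continuous (fun x : 'rV[R]_n => x 0 j).
Proof. by move=> x; apply/differentiable_continuous/differentiable_coord. Qed.

Lemma continuous_rV (T : topologicalType) (f : T -> 'rV[R]_n) (x : T) :
  (forall j, {for x, continuous (fun y => f y 0 j)}) -> {for x, continuous f}.
Proof.
move=> cf A [P Pf PA]; rewrite /nbhs /=.
have : \forall y \near x, forall j, P 0 j (f y 0 j).
  by apply: filter_forall => j; apply: cf; exact: Pf.
by apply: filterS => y Py; apply: PA => i j; rewrite ord1.
Qed.

Lemma segment_connected (x y : 'rV[R]_n) :
  connected ((fun t : R => x + t *: (y - x)) @` `[0, 1]).
Proof.
apply: connected_continuous_connected; first exact: segment_connected.
apply: continuous_subspaceT => t.
apply: cvgD; first exact: cvg_cst.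
by apply: cvgZr_tmp.
Qed.

(** A convex set is the union of the segments issuing from one of its points, all connected and
    sharing that point. *)
Lemma convex_connected (A : set 'rV[R]_n) :
  (forall x y (t : R), A x -> A y -> t \in `[0, 1] -> A (x + t *: (y - x))) ->
  connected A.
Proof.
move=> cA; have [->|/set0P[x Ax]] := eqVneq A set0; first exact: connected0.
have -> : A = \bigcup_(y in A) ((fun t : R => x + t *: (y - x)) @` `[0, 1]).
  apply/seteqP; split=> [y Ay|_ [y Ay] [t t01 <-]]; last exact: cA.
  exists y => //; exists 1; first by rewrite /= in_itv/= ler01 lexx.
  by rewrite scale1r addrCA subrr addr0.
apply: bigcup_connected; last by move=> y _; exact: segment_connected.
exists x => y Ay; exists 0; first by rewrite /= in_itv/= ler01 lexx.
by rewrite scale0r addr0.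
Qed.

Lemma rV_connected : connected [set: 'rV[R]_n].
Proof. exact: convex_connected. Qed.

Lemma ball_connected (x : 'rV[R]_n) e : connected (ball x e).
Proof.
apply: convex_connected => z w t xz xw; rewrite in_itv/= => /andP[t0 t1].
move: xz xw; rewrite -!ball_normE/= => xz xw.
have -> : x - (z + t *: (w - z)) = (1 - t) *: (x - z) + t *: (x - w).
  by apply/rowP => j; rewrite !mxE; ring.
rewrite (le_lt_trans (ler_normD _ _))// !normrZ ger0_norm ?subr_ge0// [`|t|]ger0_norm//.
(* The strict inequality is carried by the term with factor [t], so [t = 0] is treated apart. *)
have [->|tn0] := eqVneq t 0; first by rewrite subr0 mul1r mul0r addr0.
have tp : 0 < t by rewrite lt_neqAle eq_sym tn0.
have -> : e = (1 - t) * e + t * e by ring.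
by rewrite ler_ltD ?ltr_pM2l// ler_wpM2l ?subr_ge0// ltW.
Qed.

Lemma jacobian_id (x : 'rV[R]_n) : jacobian (@id 'rV[R]_n) x = 1%:M.
Proof.
rewrite /jacobian; apply/row_matrixP => i; rewrite !rowE mul_rV_lin1 diff_val mulmx1.
by [].
Qed.

Lemma rV_not_compact : (0 < n)%N -> ~ compact [set: 'rV[R]_n].
Proof.
move=> n0 /compact_bounded [N [_ /(_ (N + 1))]].
rewrite ltrDl ltr01 => /(_ isT (const_mx (`|N| + 2)) I) /=; apply/negP; rewrite -ltNge.
rewrite [ltRHS]/Num.Def.normr/= mx_normrE.
apply: lt_le_trans (le_bigmax _ _ (ord0, Ordinal n0)) => /=.
rewrite !mxE ger0_norm; first by have := ler_norm N; lra.
by have := normr_ge0 N; lra.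
Qed.

End rV_topology.

(** * The Riemannian manifold *)

Section solv_manifold.
Variables (R : realType) (m : nat).

(** One chart, indexed by [unit], with identity coordinates. The definition is transparent so that
    points of the manifold are row vectors by conversion. *)
Definition rV_manifold : manifold R m.+1.
Proof.
refine (@Manifold R m.+1 'rV[R]_m.+1 _ _ _ unit (fun=> setT) (fun=> id) (fun=> id)
  (fun=> tt) _ _ _ _ _ _ _).
- exact: norm_hausdorff.
- exact: rV_second_countable.
- exact: rV_connected.
- by move=> _; exact: openT.
- by move=> _; rewrite image_id; exact: openT.
- by [].
- by move=> _ p _; exact: cvg_id.
- by move=> _ p _; exact: cvg_id.
- by [].
- by move=> c d k; exact: smooth_on_coord.
Defined.

Variable a : 'I_m.+1 -> R.

Definition solv_metric : metric rV_manifold.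
Proof.
refine (@Metric R m.+1 rV_manifold (fun _ x => solv_mx a x) _ _ _ _).
- by move=> c i j; exact: smooth_on_solv_mx.
- by move=> c p _; rewrite tr_diag_mx.
- move=> c p v _ v0; rewrite quad_solv_mx.
  have [j vj] : exists j, v 0 j != 0.
    apply/existsP; apply: contraNT v0; rewrite negb_exists => /forallP v0.
    by apply/eqP/rowP => j; rewrite mxE; apply/eqP; have := v0 j; rewrite negbK.
  rewrite (bigD1 j)//= ltr_pwDl//.
    by rewrite mulr_gt0 ?warp_gt0// exprn_even_gt0.
  by apply: sumr_ge0 => i _; rewrite mulr_ge0 ?sqr_ge0// ltW ?warp_gt0.
- move=> c d p _ _; rewrite /transition_jacobian /=.
  by rewrite jacobian_id trmx1 mul1mx mulmx1.
Defined.

Hypothesis a0 : a 0 = 0.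

Lemma scalar_curvature_solv (x : rV_manifold) :
  scalar_curvature solv_metric x = - ((\sum_i a i) ^+ 2 + \sum_i a i ^+ 2).
Proof. exact: scalar_solv. Qed.

Lemma det_solv_mx (x : 'rV[R]_m.+1) :
  Num.sqrt (\det (solv_mx a x)) = expR ((\sum_i a i) * x 0 0).
Proof.
rewrite det_diag.
under eq_bigr do rewrite mxE /warp.
rewrite -expR_sum -!mulr_suml -mulr_sumr -mulrA -[2]/(2%:R) expRM_natl.
by rewrite sqrtr_sqr gtr0_norm ?expR_gt0.
Qed.

End solv_manifold.

(** * Lebesgue measure on row vectors *)

(** Convertible with [borel (rV_manifold R m)] when [n = m.+1], so the measures built here are
    measures on the manifold. *)
Definition borel_rV (R : realType) n : measurableType _ :=
  g_sigma_algebraType (@open 'rV[R]_n).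

Section borel_rV.
Context {R : realType} {n : nat}.

Lemma continuous_borel_rV (f : 'rV[R]_n -> R) : continuous f ->
  measurable_fun setT (f : borel_rV R n -> R).
Proof.
move=> cf; apply: (measurability _ (RGenOInfty.measurableE R)).
move=> _ [_ [b ->] <-]; rewrite setTI.
by apply: sub_sigma_algebra; apply: open_comp => //; exact: interval_open.
Qed.

End borel_rV.

Section cons.
Context {R : realType} {n : nat}.

Definition rV_cons (p : measurableTypeR R * borel_rV R n) : borel_rV R n.+1 :=
  row_mx (const_mx p.1 : 'rV[R]_1) (p.2 : 'rV[R]_n).
Definition rV_uncons (x : borel_rV R n.+1) : measurableTypeR R * borel_rV R n :=
  ((x : 'rV[R]_n.+1) 0 0, rsubmx (x : 'rV[R]_(1 + n))).

Lemma rV_consK : cancel rV_cons rV_uncons.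
Proof.
move=> [t x]; rewrite /rV_uncons /rV_cons row_mxKr; congr (_, _).
by rewrite /= mxE; case: splitP => // i _; rewrite mxE.
Qed.

Lemma rV_cons0 p : (rV_cons p : 'rV[R]_n.+1) 0 0 = p.1.
Proof. exact: (congr1 fst (rV_consK p)). Qed.

Lemma rV_consS p (j : 'I_n) : (rV_cons p : 'rV[R]_n.+1) 0 (lift ord0 j) = (p.2 : 'rV[R]_n) 0 j.
Proof.
rewrite mxE; case: splitP => [i|k]; first by rewrite ord1 /= /bump.
by rewrite /= /bump /= => -[kj]; congr (p.2 0 _); exact/val_inj.
Qed.

(** An open set is the countable union of the rational balls that it contains, and in the sup norm
    the preimage of a ball is a ball of [R] times a ball of the lower-dimensional space. *)
Lemma measurable_rV_cons :
  measurable_fun setT rV_cons.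
Proof.
refine (@measurability _ _ _ (borel_rV R n.+1) _ _ (@open 'rV[R]_n.+1) erefl _).
move=> _ [U oU <-]; rewrite setTI.
pose F (q : 'rV[rat]_n.+1 * nat) : set (measurableTypeR R * borel_rV R n) :=
  if `[< rat_ball q `<=` U >] then rV_cons @^-1` (rat_ball q) else set0.
have -> : rV_cons @^-1` U = \bigcup_q F q.
  apply/seteqP; split=> [p /= Up|p [q _]]; rewrite /F.
    have [q [qp qU]] := open_rat_ball oU Up.
    by exists q => //; rewrite asboolT.
  by case: asboolP => // qU /qU.
apply: countable_bigcupT_measurable; first exact: countableP.
move=> q; rewrite /F; case: asboolP => // _.
have d0 : 0 < q.2.+1%:R^-1 :> R by rewrite invr_gt0.
have -> : rV_cons @^-1` (rat_ball q) =
    ball (ratr (q.1 0 0) : R) q.2.+1%:R^-1 `*`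
    ball (\row_j ratr (q.1 0 (lift ord0 j)) : 'rV[R]_n) q.2.+1%:R^-1.
  apply/seteqP; split=> [p [_ /= bp]|p [/= b0 [_ bS]]].
    split=> /=.
      by have := bp 0 0; rewrite rV_cons0 mxE.
    split=> // i j; rewrite ord1 mxE.
    by have := bp 0 (lift ord0 j); rewrite rV_consS mxE.
  split=> // i j; rewrite ord1 mxE; case: (unliftP ord0 j) => [k ->|->].
    by rewrite rV_consS; have := bS 0 k; rewrite mxE.
  by rewrite rV_cons0.
apply: measurableX; first exact: measurable_ball.
apply: sub_sigma_algebra; exact: ball_open.
Qed.

Lemma measurable_rV_uncons :
  measurable_fun setT rV_uncons.
Proof.
apply: measurable_fun_pair.
    apply: (@continuous_borel_rV _ _ (fun x : 'rV[R]_n.+1 => x 0 0)) => x; exact: continuous_coord.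
refine (@measurability _ _ _ (borel_rV R n) _ _ (@open 'rV[R]_n) erefl _).
move=> _ [U oU <-]; rewrite setTI.
apply: sub_sigma_algebra.
apply: (@open_comp _ _ (fun x : 'rV[R]_n.+1 => rsubmx (x : 'rV[R]_(1 + n)))) => // x _.
apply: continuous_rV => j.
have -> : (fun y : 'rV[R]_n.+1 => rsubmx (y : 'rV[R]_(1 + n)) 0 j) =
    fun y => y 0 (rshift 1 j) by apply/funext => y; rewrite mxE.
exact: continuous_coord.
Qed.

End cons.

Section with_sigma_finite.
Context d (T : measurableType d) (R : realType) (m : {measure set T -> \bar R}).
Hypothesis h : sigma_finite setT m.

(** An alias that takes the proof as an argument, so that the sigma-finite structure can be attached
    to it. *)
Definition with_sigma_finite of sigma_finite setT m : set T -> \bar R := m.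

HB.instance Definition _ := Measure.copy (with_sigma_finite h) m.
HB.instance Definition _ := Measure_isSigmaFinite.Build _ _ _ (with_sigma_finite h) h.

End with_sigma_finite.

Section pushforward_sigma_finite.
Context d1 d2 (T1 : measurableType d1) (T2 : measurableType d2) (R : realType).
Variables (mu : {measure set T1 -> \bar R}) (f : T1 -> T2) (g : T2 -> T1).
Hypothesis mf : measurable_fun setT f.
Hypothesis mg : measurable_fun setT g.
Hypothesis fK : cancel f g.

Lemma sigma_finite_pushforward :
  sigma_finite setT mu -> sigma_finite setT (pushforward mu f).
Proof.
move=> [F FT Foo].
exists (fun k => g @^-1` F k).
  by rewrite -preimage_bigcup -FT preimage_setT.
move=> k; have [mF Fk] := Foo k.
split; first by rewrite -[X in measurable X]setTI; exact: mg.
rewrite /pushforward -comp_preimage.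
by rewrite (_ : g \o f = id) ?preimage_id//; apply/funext => x /=; rewrite fK.
Qed.

End pushforward_sigma_finite.

(** Both exhaustions are taken nondecreasing, so that the products [F k] times [G k] with a common
    index already cover the plane. *)
Lemma sigma_finite_prod d1 d2 (T1 : measurableType d1) (T2 : measurableType d2)
    (R : realType) (m1 : {sigma_finite_measure set T1 -> \bar R})
    (m2 : {sigma_finite_measure set T2 -> \bar R}) :
  sigma_finite setT (m1 \x m2)%E.
Proof.
have /sigma_finiteP[F [TF ndF Foo]] := sigma_finiteT m1.
have /sigma_finiteP[G [TG ndG Goo]] := sigma_finiteT m2.
exists (fun k => F k `*` G k).
  rewrite -setXTT TF TG; apply/seteqP; split=> [[x y] [[i _ Fi] [j _ Gj]]|p [k _ [Fk Gk]]].
    exists (maxn i j) => //; split.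
      by have /subsetPset := ndF _ _ (leq_maxl i j); exact.
    by have /subsetPset := ndG _ _ (leq_maxr i j); exact.
  by split; exists k.
move=> k; have [mF Fk] := Foo k; have [mG Gk] := Goo k; split; first exact: measurableX.
by rewrite product_measure1E// lte_mul_pinfty// ge0_fin_numE.
Qed.

Section lebesgue_rV.
Context {R : realType}.

Let step n (mu : {sigma_finite_measure set (borel_rV R n) -> \bar R}) :
    {measure set (borel_rV R n.+1) -> \bar R} :=
  measure_function_pushforward__canonical__measure_function_Measure
    (lebesgue_measure \x mu)%E (@measurable_rV_cons R n).

Let step_sigma_finite n (mu : {sigma_finite_measure set (borel_rV R n) -> \bar R}) :
  sigma_finite setT (step mu).
Proof.
have h := sigma_finite_prod lebesgue_measure mu.
have := sigma_finite_pushforward measurable_rV_uncons rV_consK h.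
exact.
Qed.

(** Sigma-finiteness is carried through the recursion because the next product measure and Tonelli's
    theorem both rely on it. *)
Fixpoint lebesgue_rV n : {sigma_finite_measure set (borel_rV R n) -> \bar R} :=
  match n with
  | 0 => \d_(0 : borel_rV R 0)
  | m.+1 => with_sigma_finite (step_sigma_finite (lebesgue_rV m))
  end.

Section tonelli.
Context {n : nat} (f : borel_rV R n.+1 -> \bar R).
Hypothesis mf : measurable_fun setT f.
Hypothesis f0 : forall x, (0 <= f x)%E.

Let integral_cons :
  (\int[lebesgue_rV n.+1]_x f x = \int[lebesgue_measure \x lebesgue_rV n]_p f (rV_cons p))%E.
Proof.
have := ge0_integral_pushforward (@measurable_rV_cons R n)
  (lebesgue_measure \x lebesgue_rV n)%E measurableT mf.
by rewrite preimage_setT => <-.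
Qed.

Lemma tonelli_rV1 : (\int[lebesgue_rV n.+1]_x f x =
  \int[lebesgue_measure]_t \int[lebesgue_rV n]_x f (rV_cons (t, x)))%E.
Proof.
rewrite integral_cons (fubini_tonelli1 (f \o rV_cons))//.
- exact: measurableT_comp mf (@measurable_rV_cons R n).
- by move=> p; exact: f0.
Qed.

(** The order with the [t]-line innermost is the one in which the Hardy inequality is integrated;
    the other order matches [lebesgue_integral_rV]. *)
Lemma tonelli_rV2 : (\int[lebesgue_rV n.+1]_x f x =
  \int[lebesgue_rV n]_x \int[lebesgue_measure]_t f (rV_cons (t, x)))%E.
Proof.
rewrite integral_cons (fubini_tonelli2 (f \o rV_cons))//.
- exact: measurableT_comp mf (@measurable_rV_cons R n).
- by move=> p; exact: f0.
Qed.

End tonelli.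

(** Links the iterated integral that specifies a Riemannian volume to integration against an actual
    measure. *)
Lemma lebesgue_integral_rVE n (f : borel_rV R n -> \bar R) :
  measurable_fun setT f -> (forall x, (0 <= f x)%E) ->
  lebesgue_integral_rV f = (\int[lebesgue_rV n]_x f x)%E.
Proof.
elim: n f => [|n IHn] f mf f0.
  by rewrite /= integral_dirac// diracT mul1e.
rewrite tonelli_rV1//; apply: eq_integral => t _.
apply: (IHn (fun x => f (rV_cons (t, x)))) => //.
apply: (measurableT_comp mf); apply: (measurableT_comp (@measurable_rV_cons R n)).
exact: measurable_fun_pair.
Qed.

End lebesgue_rV.

(** * Measures given by a density *)

Section density.
Local Open Scope ereal_scope.
Context d (T : measurableType d) (R : realType).
Variables (mu : {measure set T -> \bar R}) (w : T -> R).
Hypothesis mw : measurable_fun setT w.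
Hypothesis w0 : forall x, (0 <= w x)%R.

Definition with_density of measurable_fun setT w & (forall x, (0 <= w x)%R) :
  set T -> \bar R := fun A => \int[mu]_(x in A) (w x)%:E.

Let density0 : with_density mw w0 set0 = 0.
Proof. exact: integral_set0. Qed.

Let density_ge0 A : 0 <= with_density mw w0 A.
Proof. by apply: integral_ge0 => x _; rewrite lee_fin. Qed.

Let density_sigma_additive : semi_sigma_additive (with_density mw w0).
Proof.
move=> F mF tF mUF; rewrite /with_density ge0_integral_bigcup//.
- apply: is_cvg_ereal_nneg_natsum_cond => k _ _.
  exact: density_ge0.
- exact/measurable_funTS/measurable_EFinP.
- by move=> x _; rewrite lee_fin.
Qed.

HB.instance Definition _ := isMeasure.Build _ _ _ (with_density mw w0)
  density0 density_ge0 density_sigma_additive.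

Import HBNNSimple.

(** Monotone convergence on both sides reduces to simple functions, and linearity to the indicator
    of a level set, where the equality is the definition of the measure. *)
Lemma ge0_integral_with_density (f : T -> \bar R) D : measurable D ->
  measurable_fun D f -> (forall x, 0 <= f x) ->
  \int[with_density mw w0]_(x in D) f x = \int[mu]_(x in D) (f x * (w x)%:E).
Proof.
move=> mD mf f0.
pose h := nnsfun_approx mD mf.
have mwD : measurable_fun D (EFin \o w) by exact/measurable_funTS/measurable_EFinP.
have mh n : measurable_fun D (EFin \o h n).
  by apply/measurable_EFinP/measurable_funTS.
have ch x : D x -> (EFin \o h n) x @[n --> \oo] --> f x.
  by move=> Dx; exact: cvg_nnsfun_approx.
have hm x : D x -> {homo (fun n => (h n x)%:E) : m n / (m <= n)%N >-> m <= n}.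
  by move=> Dx a b ab; rewrite lee_fin; exact/lefP/nd_nnsfun_approx.
transitivity (limn (fun n => \int[with_density mw w0]_(x in D) (h n x)%:E)).
  rewrite -monotone_convergence//; last by move=> n x _; rewrite lee_fin.
  by apply: eq_integral => x /[!inE] Dx; apply/esym/cvg_lim => //; exact: ch.
transitivity (limn (fun n => \int[mu]_(x in D) ((h n x)%:E * (w x)%:E))); last first.
  rewrite -monotone_convergence; [|by []|move=> n; exact: (emeasurable_funM (mh n) mwD)| |].
  - apply: eq_integral => x /[!inE] Dx; apply/cvg_lim => //.
    by apply: cvgeZr => //; exact: ch.
  - by move=> n x _; rewrite -EFinM lee_fin mulr_ge0.
  - by move=> x Dx a b ab; apply: lee_wpmul2r; [rewrite lee_fin|exact: hm].
congr (limn _); apply/funext => n.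
have E x : (h n x)%:E = \sum_(y \in range (h n)) (y * \1_(h n @^-1` [set y]) x)%:E.
  by rewrite [in LHS]fimfunE -fsumEFin.
have mi (y : R) : measurable_fun D (fun x => (y * \1_(h n @^-1` [set y]) x)%:E).
  by apply/measurable_EFinP; apply: measurable_funM => //; exact: measurable_indic.
transitivity (\int[with_density mw w0]_(x in D) \sum_(y \in range (h n))
    (y * \1_(h n @^-1` [set y]) x)%:E); first by apply: eq_integral => x _; exact: E.
rewrite ge0_integral_fsum//; last by move=> y x _; exact: nnfun_muleindic_ge0.
transitivity (\int[mu]_(x in D) \sum_(y \in range (h n))
    ((y * \1_(h n @^-1` [set y]) x)%:E * (w x)%:E)); last first.
  apply: eq_integral => x _; rewrite E ge0_mule_fsuml// => y.
  exact: nnfun_muleindic_ge0.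
rewrite ge0_integral_fsum//; last 2 first.
- by move=> y; exact: (emeasurable_funM (mi y) mwD).
- by move=> y x _; rewrite mule_ge0 ?lee_fin//; have := nnfun_muleindic_ge0 (h n) y x.
apply: eq_fsbigr => _ /[!inE] -[z _ <-].
set y := h n z; set A := _ @^-1` _.
have mA : measurable A.
  by rewrite -[A]setTI; exact: (measurable_funP (h n)) measurableT _ (measurable_set1 _).
have y0 : (0 <= y)%R by exact: fun_ge0.
have mA1 : measurable_fun D (fun x => (\1_A x : R)%:E).
  exact/measurable_EFinP/measurable_indic.
rewrite (eq_integral (fun x => y%:E * (\1_A x : R)%:E)); last by move=> x _; rewrite EFinM.
rewrite ge0_integralZl//.
rewrite [RHS](eq_integral (fun x => y%:E * ((\1_A x : R)%:E * (w x)%:E))); last first.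
  by move=> x _; rewrite EFinM muleA.
rewrite ge0_integralZl//; last 2 first.
- exact: (emeasurable_funM mA1 mwD).
- by move=> x _; rewrite mule_ge0 ?lee_fin.
congr (_ * _); rewrite integral_indic//= /with_density setIC integral_mkcondr.
by apply: eq_integral => x _; rewrite epatch_indic muleC.
Qed.

End density.

(** * The weighted Hardy inequality *)

Section continuous_arith.
Context {R : realType} {T : topologicalType}.
Implicit Types f g : T -> R.

Lemma continuous_mul f g : continuous f -> continuous g ->
  continuous (fun x => f x * g x).
Proof. by move=> cf cg x; exact: (continuousM (cf x) (cg x)). Qed.

Lemma continuous_add f g : continuous f -> continuous g ->
  continuous (fun x => f x + g x).
Proof. by move=> cf cg x; exact: (continuousD (cf x) (cg x)). Qed.

Lemma continuous_sub f g : continuous f -> continuous g ->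
  continuous (fun x => f x - g x).
Proof. by move=> cf cg x; exact: (continuousB (cf x) (cg x)). Qed.

Lemma continuous_at_sqr f x :
  {for x, continuous f} -> {for x, continuous (fun y => f y ^+ 2)}.
Proof.
by move=> cf; rewrite (_ : (fun _ => _) = f \* f)//; exact: continuousM.
Qed.

Lemma continuous_sqr f : continuous f -> continuous (fun x => f x ^+ 2).
Proof. by move=> cf x; exact: continuous_at_sqr (cf x). Qed.

Lemma continuous_sum (I : Type) (r : seq I) (f : I -> T -> R) (x : T) :
  (forall j, {for x, continuous (f j)}) ->
  {for x, continuous (fun y => \sum_(j <- r) f j y)}.
Proof.
move=> cf; elim: r => [|j r IHr].
  rewrite (_ : (fun y => _) = cst 0); first exact: cst_continuous.
  by apply/funext => y; rewrite big_nil.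
rewrite (_ : (fun y => _) = (fun y => f j y + \sum_(j <- r) f j y)).
  exact: (continuousD (cf j) IHr).
by apply/funext => y; rewrite big_cons.
Qed.

End continuous_arith.

Section FTC.
Context {R : realType}.
Implicit Types (F f : R -> R) (a b : R).
Local Notation mu := (@lebesgue_measure R).

Lemma derive_continuous_oo F f a b : (forall t : R, is_derive t 1 F (f t)) ->
  derivable_oo_LRcontinuous F a b.
Proof.
move=> dF.
have cF t : {for t, continuous F}.
  by apply/differentiable_continuous/derivable1_diffP; have [] := dF t.
split; first by move=> t _; have [] := dF t.
- apply: cvg_at_right_filter; exact: cF.
- apply: cvg_at_left_filter; exact: cF.
Qed.

Lemma integral_derive F f a b : a < b -> (forall t : R, is_derive t 1 F (f t)) ->
  continuous f -> (\int[mu]_(t in `[a, b]) (f t)%:E = (F b - F a)%:E)%E.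
Proof.
move=> ab dF cf; rewrite (continuous_FTC2 ab _ (derive_continuous_oo _ _ dF)) ?EFinB//.
- exact: continuous_subspaceT.
- by move=> t _; rewrite derive1E; have [_] := dF t.
Qed.

End FTC.

Section hardy.
Context {R : realType}.
Variables (u u' : R -> R) (p beta : R).
Local Notation mu := (@lebesgue_measure R).
Hypothesis p0 : 0 < p.
Hypothesis du : forall t : R, is_derive t 1 u (u' t).
Hypothesis cu' : continuous u'.
Hypothesis u0 : forall t, p <= `|t| -> u t = 0.

(** On [|t| <= p] the gain [delta - delta^2 t^2] is at least [delta - delta^2 p^2]. This value of
    [delta] maximises that lower bound, which becomes [1 / (4 p^2)], the second term of
    [hardy_constant]. *)
Let delta : R := (2 * p ^+ 2)^-1.
Definition hardy_constant : R := beta ^+ 2 / 4 + (4 * p ^+ 2)^-1.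

Let cu : continuous u.
Proof. by move=> t; apply/differentiable_continuous/derivable1_diffP; have [] := du t. Qed.

(* For any q, [(u')^2 >= 2 q u u' - q^2 u^2]. Adding the derivative of [- q u^2 e], which
   integrates to zero, leaves [u^2 (- q' - beta q - q^2) e]; q is [- beta / 2], which
   maximises the factor among constants, perturbed to gain [delta - delta^2 t^2]. *)
Let q t : R := - beta / 2 - delta * t.
Let e t : R := expR (beta * t).
Let F t : R := u t ^+ 2 * q t * e t.
Let F' t : R := (2 * u t * u' t * q t + u t ^+ 2 * (- delta + beta * q t)) * e t.

Let dq (t : R) : is_derive t 1 q (- delta).
Proof.
rewrite (_ : q = cst (- beta / 2) - delta \*: id); last exact/funext.
by apply: is_derive_eq; rewrite sub0r [delta *: 1]mulr1.
Qed.

Let de (t : R) : is_derive t 1 e (beta * e t).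
Proof.
have := is_derive_expR_affine 1 0 beta t.
by rewrite mul1r add0r; under eq_fun do rewrite add0r mul1r.
Qed.

Let dF (t : R) : is_derive t 1 F (F' t).
Proof.
rewrite (_ : F = (u ^+ 2) * q * e); last exact/funext.
apply: is_derive_eq; rewrite /F' /GRing.scale/= expr1 -/(e t) !fctE; ring.
Qed.

Let ce : continuous e.
Proof. by move=> t; apply/differentiable_continuous/derivable1_diffP; have [] := de t. Qed.
Let cq : continuous q.
Proof. by move=> t; apply/differentiable_continuous/derivable1_diffP; have [] := dq t. Qed.

Let cF' : continuous F'.
Proof.
apply: continuous_mul ce; apply: continuous_add.
  apply: continuous_mul cq; apply: continuous_mul cu'.
  by apply: continuous_mul cu => t; exact: cvg_cst.
apply: continuous_mul; first exact: continuous_sqr.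
apply: continuous_add; first by move=> t; exact: cvg_cst.
by apply: continuous_mul cq => t; exact: cvg_cst.
Qed.

Lemma hardy1 :
  (\int[mu]_t (hardy_constant * u t ^+ 2 * expR (beta * t))%:E <=
   \int[mu]_t (u' t ^+ 2 * expR (beta * t))%:E)%E.
Proof.
pose G t : R := hardy_constant * u t ^+ 2 * e t.
pose H t : R := u' t ^+ 2 * e t.
have e0 t : 0 < e t by exact: expR_gt0.
have k0 : 0 <= hardy_constant.
  by rewrite /hardy_constant addr_ge0// ?divr_ge0 ?sqr_ge0// invr_ge0 mulr_ge0 ?sqr_ge0.
have G0 t : 0 <= G t by apply: mulr_ge0 (ltW (e0 t)); rewrite mulr_ge0 ?sqr_ge0.
have H0 t : 0 <= H t by apply: mulr_ge0 (ltW (e0 t)); exact: sqr_ge0.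
have cG : continuous G.
  apply: continuous_mul ce; apply: continuous_mul; last exact: continuous_sqr.
  by move=> t; exact: cvg_cst.
have cH : continuous H.
  by apply: continuous_mul ce; exact: continuous_sqr.
have pp : - p < p by rewrite gtrN.
pose I : set R := `[- p, p]%classic.
have mI : measurable I by exact: measurable_itv.
have FF : (\int[mu]_(t in I) (F' t)%:E = 0)%E.
  have up : u p = 0 by apply: u0; rewrite gtr0_norm.
  have uNp : u (- p) = 0 by apply: u0; rewrite normrN gtr0_norm.
  rewrite (integral_derive pp dF cF') /F up uNp.
  by rewrite expr0n/= !mul0r subrr.
(* Completing the square: beyond [G t], what remains is [(u' - q u)^2] plus a multiple of [u^2] that
   is nonnegative because [delta * t ^+ 2 <= 1 / 2] on [I]. *)
have GH t : I t -> G t <= H t - F' t.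
  rewrite /I /= in_itv/= => /andP[tp pt].
  have dt : delta * t ^+ 2 <= 1 / 2.
    have -> : 1 / 2 = delta * p ^+ 2 by rewrite /delta; field; rewrite lt0r_neq0.
    rewrite ler_pM2l ?invr_gt0 ?mulr_gt0 ?exprn_gt0//.
    have tp' : `|t| <= p by rewrite ler_norml tp.
    by rewrite -real_normK ?num_real//; apply: lerXn2r tp' => //; rewrite nnegrE ltW.
  have -> : H t - F' t = G t +
      ((u' t - u t * q t) ^+ 2 + u t ^+ 2 * (delta * (1 / 2 - delta * t ^+ 2))) * e t.
    rewrite /H /F' /G /hardy_constant /q.
    have -> : (4 * p ^+ 2)^-1 = delta / 2 by rewrite /delta; field; rewrite lt0r_neq0.
    by field.
  rewrite lerDl mulr_ge0 ?(ltW (e0 t))// addr_ge0 ?sqr_ge0// mulr_ge0 ?sqr_ge0//.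
  by rewrite mulr_ge0 ?subr_ge0// invr_ge0 mulr_ge0 ?sqr_ge0.
have iC (f : R -> R) : continuous f -> mu.-integrable I (EFin \o f).
  move=> cf; apply: continuous_compact_integrable; first exact: segment_compact.
  exact: continuous_subspaceT.
have mC D (f : R -> R) : continuous f -> measurable_fun D (EFin \o f).
  move=> cf; apply/measurable_EFinP/measurable_funTS.
  exact: continuous_measurable_fun.
(* Restricting to [I] loses nothing of [G], since [u] vanishes outside, and can only decrease the
   integral of [H]. *)
have h1 : (\int[mu]_t (G t)%:E <= \int[mu]_(t in I) (G t)%:E)%E.
  rewrite [leRHS]integral_mkcond; apply: ge0_le_integral => //.
  - by move=> t _; rewrite lee_fin G0.
  - exact: mC.
  - by apply/(measurable_restrictT _ _).1 => //; exact: mC.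
  - move=> t _; rewrite patchE; case: ifPn => // /negP tp.
    rewrite lee_fin /G u0 ?expr0n/= ?mulr0 ?mul0r// leNgt; apply/negP => tp'; apply: tp.
    by rewrite inE /I /= in_itv/=; move: tp'; rewrite ltr_norml => /andP[/ltW -> /ltW ->].
have h2 : (\int[mu]_(t in I) (H t)%:E <= \int[mu]_t (H t)%:E)%E.
  by apply: ge0_subset_integral => //; [exact: mC|move=> t _; rewrite lee_fin H0].
have h3 : (\int[mu]_(t in I) (G t)%:E <= \int[mu]_(t in I) (H t)%:E)%E.
  have <- : (\int[mu]_(t in I) (H t - F' t)%:E = \int[mu]_(t in I) (H t)%:E)%E.
    transitivity (\int[mu]_(t in I) (H t)%:E - \int[mu]_(t in I) (F' t)%:E)%E.
      by rewrite -integralB//; [exact: iC|exact: iC].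
    by rewrite FF sube0.
  apply: ge0_le_integral => //.
  - by move=> t _; rewrite lee_fin G0.
  - exact: mC.
  - by apply: (mC _ (fun t => H t - F' t)); exact: continuous_sub.
exact: le_trans h1 (le_trans h3 h2).
Qed.

End hardy.

Section weight.
Context {R : realType} {n : nat}.
Variable beta : R.

Definition weight (x : borel_rV R n.+1) : R := expR (beta * (x : 'rV[R]_n.+1) 0 0).

Lemma continuous_weight : continuous (weight : 'rV[R]_n.+1 -> R).
Proof.
move=> x; apply/differentiable_continuous.
have -> : weight = expt 1 beta :> ('rV[R]_n.+1 -> R).
  by apply/funext => y; rewrite /expt mul1r.
exact: differentiable_expt.
Qed.

Lemma measurable_weight : measurable_fun setT weight.
Proof. exact: (continuous_borel_rV continuous_weight). Qed.

Lemma weight_ge0 x : 0 <= weight x. Proof. exact: expR_ge0. Qed.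

Definition weighted_lebesgue : {measure set (borel_rV R n.+1) -> \bar R} :=
  with_density (lebesgue_rV n.+1) measurable_weight weight_ge0.

Lemma ge0_integral_weighted (f : borel_rV R n.+1 -> \bar R) :
  measurable_fun setT f -> (forall x, (0 <= f x)%E) ->
  (\int[weighted_lebesgue]_x f x =
   \int[lebesgue_rV n.+1]_x (f x * (weight x)%:E))%E.
Proof. by move=> mf f0; rewrite ge0_integral_with_density. Qed.

Lemma weight_cons t x : weight (rV_cons (t, x)) = expR (beta * t).
Proof. by rewrite /weight rV_cons0. Qed.

Lemma rV_cons_line t (x : 'rV[R]_n) :
  rV_cons (t, x) = rV_cons (0, x) + t *: delta_mx 0 0 :> 'rV[R]_n.+1.
Proof.
apply/rowP => j; rewrite [RHS]mxE; case: (unliftP ord0 j) => [k ->|->].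
  by rewrite !rV_consS !mxE /= mulr0 addr0.
by rewrite !rV_cons0 !mxE/= mulr1 add0r.
Qed.

(** The weight is a function of [t] only, so [hardy1] applies on each line parallel to the first
    axis; the result is then integrated over the remaining coordinates. *)
Lemma hardy_rV (f : 'rV[R]_n.+1 -> R) (p : R) : 0 < p ->
  (forall x, differentiable f x) -> continuous (pderiv 0 f) ->
  (forall x : 'rV[R]_n.+1, p <= `|x 0 0| -> f x = 0) ->
  ((hardy_constant p beta)%:E * \int[weighted_lebesgue]_x (f x ^+ 2)%:E <=
   \int[weighted_lebesgue]_x (pderiv 0 f x ^+ 2)%:E)%E.
Proof.
move=> p0 df cf f0.
have k0 : 0 <= hardy_constant p beta.
  by rewrite /hardy_constant addr_ge0// ?divr_ge0 ?sqr_ge0// invr_ge0 mulr_ge0 ?sqr_ge0.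
have cf' : continuous f by move=> x; exact: differentiable_continuous.
(* Stated with a factor [c] to serve both sides, with the Hardy constant and with 1. *)
have step (c : R) (g : 'rV[R]_n.+1 -> R) : 0 <= c -> continuous g ->
    (c%:E * \int[weighted_lebesgue]_x (g x ^+ 2)%:E = \int[lebesgue_rV n]_y
      \int[lebesgue_measure]_t (c * g (rV_cons (t, y)) ^+ 2 * expR (beta * t))%:E)%E.
  move=> c0 cg.
  have m2 : measurable_fun setT (fun x : borel_rV R n.+1 => (g x ^+ 2)%:E).
    apply/measurable_EFinP; apply: (continuous_borel_rV (f := fun x => g x ^+ 2)).
    exact: continuous_sqr.
  have mM : measurable_fun setT (fun x : borel_rV R n.+1 => (c * g x ^+ 2 * weight x)%:E).
    apply/measurable_EFinP.
    apply: (continuous_borel_rV (f := fun x => c * g x ^+ 2 * weight x)).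
    apply: continuous_mul continuous_weight; apply: continuous_mul; last exact: continuous_sqr.
    exact: cst_continuous.
  rewrite ge0_integral_weighted; [|exact: m2|by move=> x; rewrite lee_fin sqr_ge0].
  rewrite -ge0_integralZl//; last first.
  - by move=> x _; rewrite -EFinM lee_fin mulr_ge0 ?sqr_ge0 ?weight_ge0.
  - by apply: emeasurable_funM m2 _; apply/measurable_EFinP; exact: measurable_weight.
  rewrite (eq_integral (fun x : borel_rV R n.+1 => (c * g x ^+ 2 * weight x)%:E)); last first.
    by move=> x _; rewrite -!EFinM mulrA.
  rewrite (tonelli_rV2 mM); last first.
    by move=> x; rewrite lee_fin mulr_ge0 ?weight_ge0// mulr_ge0// sqr_ge0.
  by apply: eq_integral => y _; apply: eq_integral => t _; rewrite weight_cons.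
rewrite -[leRHS]mul1e !step//.
have tm (c : R) (g : 'rV[R]_n.+1 -> R) : 0 <= c -> continuous g -> measurable_fun setT
    (fun y : borel_rV R n => (\int[lebesgue_measure]_t
      (c * g (rV_cons (t, y)) ^+ 2 * expR (beta * t))%:E)%E).
  move=> c0 cg.
  apply: (measurable_fun_fubini_tonelli_G (fun p : measurableTypeR R * borel_rV R n =>
     (c * g (rV_cons p) ^+ 2 * expR (beta * p.1))%:E)); last first.
    by move=> x; rewrite lee_fin mulr_ge0 ?expR_ge0// mulr_ge0// sqr_ge0.
  apply/measurable_EFinP; apply: measurable_funM.
    apply: (measurableT_comp (f := fun x : borel_rV R n.+1 => c * g x ^+ 2)).
      apply: (continuous_borel_rV (f := fun x => c * g x ^+ 2)).
      apply: continuous_mul; last exact: continuous_sqr.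
      exact: cst_continuous.
    exact: measurable_rV_cons.
  apply: measurableT_comp; first exact: measurable_expR.
  by apply: measurable_funM => //; exact: measurable_fst.
apply: ge0_le_integral => //.
- move=> y _; apply: integral_ge0 => t _.
  by rewrite lee_fin mulr_ge0 ?expR_ge0// mulr_ge0// sqr_ge0.
- exact: tm.
- exact: tm.
move=> y _; under [leRHS]eq_integral do rewrite mul1r.
have du (t : R) : is_derive t 1 (fun t : R => f (rV_cons (t, y))) (pderiv 0 f (rV_cons (t, y))).
  rewrite rV_cons_line; under eq_fun do rewrite rV_cons_line.
  by apply: is_derive_line; exact: diff_derivable.
apply: hardy1 du _ _ => //.
  have -> : (fun t : R => pderiv 0 f (rV_cons (t, y))) =
    pderiv 0 f \o (fun t : R => (rV_cons (0, y) : 'rV[R]_n.+1) + t *: delta_mx 0 0).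
    by apply/funext => t /=; rewrite rV_cons_line.
  move=> t; apply: continuous_comp; last exact: cf.
  by apply: cvgD; [exact: cvg_cst|exact: cvgZr_tmp].
by move=> t pt; apply: f0; rewrite rV_cons0.
Qed.

End weight.

(** * Boxes *)

Section box.
Context {R : realType}.
Implicit Types (p q beta : R).

Definition cube n q : set 'rV[R]_n := [set x | forall j, `|x 0 j| < q].

Definition slab n p q : set 'rV[R]_n.+1 :=
  [set x | `|x 0 0| < p /\ forall j : 'I_n, `|x 0 (lift ord0 j)| < q].

Arguments cube : clear implicits.
Arguments slab : clear implicits.

Lemma cube_slab n q : cube n.+1 q = slab n q q.
Proof.
apply/seteqP; split=> [x xq|x [x0 xS] j]; first by split => [|j]; exact: xq.
by case: (unliftP ord0 j) => [k ->|->].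
Qed.

Lemma open_slab n p q : open (slab n p q).
Proof.
have oj (j : 'I_n.+1) (c : R) : open [set x : 'rV[R]_n.+1 | `|x 0 j| < c].
  apply: (@open_comp _ _ (fun x : 'rV[R]_n.+1 => `|x 0 j|) [set y | y < c]).
    move=> x _.
    apply: (@continuous_comp _ _ _ (fun x : 'rV[R]_n.+1 => x 0 j) (fun y => `|y|)).
      exact: continuous_coord.
    exact: norm_continuous.
  exact: open_lt.
rewrite openE => x [x0 xS].
have xj : \forall y \near (x : 'rV[R]_n.+1), forall j : 'I_n,
    `|(y : 'rV[R]_n.+1) 0 (lift ord0 j)| < q.
  apply: (@filter_forall _ _ (fun (j : 'I_n) (y : 'rV[R]_n.+1) => `|y 0 (lift ord0 j)| < q)
    (nbhs x) (nbhs_filter x)) => j.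
  exact: (open_nbhs_nbhs (conj (oj (lift ord0 j) q) (xS j))).
have x0' : \forall y \near (x : 'rV[R]_n.+1), `|(y : 'rV[R]_n.+1) 0 0| < p.
  exact: (open_nbhs_nbhs (conj (oj 0 p) x0)).
by rewrite /interior; near=> y; split; near: y.
Unshelve. all: by end_near.
Qed.

Lemma open_cube n q : open (cube n q).
Proof.
case: n => [|n]; last by rewrite cube_slab; exact: open_slab.
rewrite (_ : cube 0 q = setT); first exact: openT.
by apply/seteqP; split=> // x _ [].
Qed.

Lemma measurable_cube n q : measurable (cube n q : set (borel_rV R n)).
Proof. apply: sub_sigma_algebra; exact: open_cube. Qed.

Lemma measurable_slab n p q : measurable (slab n p q : set (borel_rV R n.+1)).
Proof. apply: sub_sigma_algebra; exact: open_slab. Qed.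

Lemma slab_cons n p q t (x : 'rV[R]_n) :
  slab n p q (rV_cons (t, x)) <-> `|t| < p /\ cube n q x.
Proof.
split=> -[tp h]; split.
- by move: tp; rewrite rV_cons0.
- by move=> j; have := h j; rewrite rV_consS.
- by rewrite rV_cons0.
- by move=> j; rewrite rV_consS; exact: h.
Qed.

Local Open Scope ereal_scope.

(** The width [q] enters only through the volume of the cross-section, the factor that drops out of
    the volume ratio up to a power of 2. *)
Lemma integral_slab n p q (g : R -> R) : measurable_fun setT g -> (forall t, 0 <= g t)%R ->
  \int[lebesgue_rV n.+1]_x ((\1_(slab n p q) x : R) * g ((x : 'rV[R]_n.+1) 0 0)%R)%:E =
  \int[lebesgue_measure]_(t in `](- p)%R, p[) (g t)%:E * lebesgue_rV n (cube n q).
Proof.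
move=> mg g0; rewrite tonelli_rV1; last 2 first.
- apply/measurable_EFinP; apply: measurable_funM.
    by apply: measurable_indic; exact: measurable_slab.
  apply: measurableT_comp => //.
  apply: (continuous_borel_rV (f := fun x : 'rV[R]_n.+1 => x 0%R 0%R)).
  exact: continuous_coord.
- by move=> x; rewrite lee_fin mulr_ge0.
transitivity (\int[lebesgue_measure]_t
   ((lebesgue_rV n (cube n q)) * ((\1_(`](- p)%R, p[%classic : set R) t : R) * g t)%:E)).
  apply: eq_integral => t _.
  transitivity (\int[lebesgue_rV n]_x (((\1_(`](- p)%R, p[%classic : set R) t : R) * g t)%:E *
       (\1_(cube n q) x : R)%:E)).
    apply: eq_integral => x _; rewrite rV_cons0 -EFinM mulrAC; congr (_ * _)%:E.
    rewrite !indicE -natrM mulnb; congr (nat_of_bool _)%:R.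
    apply/idP/andP; rewrite !inE/= in_itv/= -ltr_norml => /slab_cons//.
  have mC := @measurable_cube n q.
  rewrite ge0_integralZl; [|by []| |by move=> x _; rewrite lee_fin|by rewrite lee_fin mulr_ge0].
    by rewrite integral_indic// setIT muleC.
  exact/measurable_EFinP/measurable_indic.
rewrite ge0_integralZl; [|by []| |by move=> t _; rewrite lee_fin mulr_ge0|by []]; last first.
  by apply/measurable_EFinP; apply: measurable_funM => //; exact: measurable_indic.
rewrite muleC [in RHS]integral_mkcond; congr (_ * _); apply: eq_integral => t _.
by rewrite epatch_indic EFinM muleC.
Qed.

Lemma lebesgue_cube n q : (0 < q)%R -> lebesgue_rV n (cube n q) = ((2 * q) ^+ n)%:E.
Proof.
move=> q0; elim: n => [|n IHn].
  by rewrite /= diracE mem_set// => -[].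
have m1 : measurable_fun setT (cst 1%R : R -> R) by exact: measurable_cst.
have := @integral_slab n q q _ m1 (fun=> ler01).
under eq_integral do rewrite mulr1.
rewrite integral_indic ?setIT//; last exact: measurable_slab.
rewrite -cube_slab IHn => ->.
rewrite exprS EFinM; congr (_ * _).
rewrite -[LHS]/(\int[lebesgue_measure]_(t in _) (cst 1%:E) t).
rewrite integral_cst//= mul1e lebesgue_measure_itv/= lte_fin gtrN// -EFinB opprK.
by rewrite -mulr2n mulr_natl.
Qed.

Lemma integral_expR_itv p beta : (0 < beta)%R -> (0 < p)%R ->
  \int[lebesgue_measure]_(t in `](- p)%R, p[) (expR (beta * t)%R)%:E <=
  (expR (beta * p) / beta)%:E.
Proof.
move=> b0 p0.
have dE (t : R) :
    is_derive t 1%R (fun s : R => beta^-1 * expR (0 + beta * s))%R (expR (beta * t)%R).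
  have := is_derive_expR_affine beta^-1%R 0%R beta t.
  by rewrite mulVf ?lt0r_neq0// mul1r add0r.
have ce : continuous (fun t : R => expR (beta * t)%R).
  move=> t; apply/differentiable_continuous/derivable1_diffP.
  have [+ _] := is_derive_expR_affine 1%R 0%R beta t.
  by under eq_fun do rewrite mul1r add0r.
have me : measurable_fun setT (fun t : R => (expR (beta * t)%R)%:E).
  by apply/measurable_EFinP; exact: continuous_measurable_fun ce.
apply: (@le_trans _ _ (\int[lebesgue_measure]_(t in `[(- p)%R, p]) (expR (beta * t)%R)%:E)).
  apply: ge0_subset_integral => //.
  - exact: measurable_funTS.
  - exact: subset_itv_oo_cc.
rewrite (integral_derive _ dE ce); last by rewrite gtrN.
rewrite lee_fin !add0r mulrC lerBlDr lerDl mulr_ge0 ?expR_ge0// invr_ge0 ltW//.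
Qed.

Lemma le_integral_expR_itv beta : (0 < beta)%R ->
  (2 * expR (- beta))%:E <= \int[lebesgue_measure]_(t in `](- 1)%R, 1%R[) (expR (beta * t)%R)%:E.
Proof.
move=> b0.
have me : measurable_fun setT (fun t : R => (expR (beta * t)%R)%:E).
  apply/measurable_EFinP; apply: measurableT_comp; first exact: measurable_expR.
  by apply: measurable_funM.
apply: (@le_trans _ _ (\int[lebesgue_measure]_(t in `](- 1)%R, 1%R[) (expR (- beta))%:E)).
  rewrite integral_cst//= lebesgue_measure_itv/= lte_fin ifT ?gtrN//.
  by rewrite -EFinB -EFinM opprK mulrC lee_fin.
apply: ge0_le_integral => //.
- exact: measurable_funTS.
- move=> t; rewrite /= in_itv/= => /andP[t1 _].
  by rewrite lee_fin ler_expR -mulrN1 ler_pM2l// ltW.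
Qed.

Lemma weighted_slab n p q beta : (0 < q)%R ->
  weighted_lebesgue beta (slab n p q) =
  \int[lebesgue_measure]_(t in `](- p)%R, p[) (expR (beta * t)%R)%:E * ((2 * q) ^+ n)%:E.
Proof.
move=> q0; rewrite -lebesgue_cube// -integral_slab; last 2 first.
- by apply: measurableT_comp; [exact: measurable_expR|exact: measurable_funM].
- by move=> t; exact: expR_ge0.
rewrite /weighted_lebesgue /= /with_density integral_mkcond.
by apply: eq_integral => x _; rewrite epatch_indic EFinM muleC.
Qed.

End box.
Arguments cube {R} n q.
Arguments slab {R} n p q.

(** * Lengths of curves and distances *)

Section curves.
Context {R : realType} {m : nat}.
Variable a : 'I_m.+1 -> R.
Hypothesis a0 : a 0 = 0.
Local Notation M := (rV_manifold R m).
Local Notation g := (solv_metric a).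
Local Notation mu := (@lebesgue_measure R).
Implicit Types (c : R -> M).

(** A common upper bound for all [|a j|]: for [|t| <= b] every coefficient [e^{2 a_j t}] lies
    between [e^{-2 E b}] and [e^{2 E b}]. *)
Definition exponent_bound : R := \sum_j `|a j|.
Local Notation E := exponent_bound.

Lemma exponent_le j t b : `|t| <= b -> `|a j * t| <= E * b.
Proof.
move=> tb; rewrite normrM ler_pM//.
by rewrite /E (bigD1 j)//= lerDl sumr_ge0.
Qed.

Definition velocity c (t : R) (j : 'I_m.+1) : R := derive1 (c : R -> 'rV[R]_m.+1) t 0 j.

Lemma speedE c t : speed g c t = Num.sqrt (\sum_j warp a j (c t) * velocity c t j ^+ 2).
Proof. by rewrite /speed quad_solv_mx. Qed.

Lemma speed_ge0 c t : 0 <= speed g c t.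
Proof. by rewrite speedE sqrtr_ge0. Qed.

Lemma curve_length_ge0 c : (0 <= curve_length g c)%E.
Proof. by apply: integral_ge0 => t _; rewrite lee_fin speed_ge0. Qed.

Lemma velocity_le c t j b : `|(c t : 'rV[R]_m.+1) 0 0| <= b ->
  `|velocity c t j| <= expR (E * b) * speed g c t.
Proof.
move=> ctb; have := exponent_le j ctb; rewrite ler_norml => /andP[ab _].
have w : expR (- (E * b)) ^+ 2 <= warp a j (c t).
  rewrite -expRM_natl /warp ler_expR; lra.
rewrite -[leLHS]mul1r -(expRxMexpNx_1 (E * b)) -mulrA ler_pM2l ?expR_gt0//.
rewrite speedE -[leLHS]ger0_norm ?mulr_ge0 ?expR_ge0// -sqrtr_sqr ler_wsqrtr//.
rewrite exprMn real_normK ?num_real// (bigD1 j)//=.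
apply: le_trans (_ : _ <= warp a j (c t) * velocity c t j ^+ 2) _.
  by rewrite ler_wpM2r ?sqr_ge0.
rewrite lerDl; apply: sumr_ge0 => i _.
by rewrite mulr_ge0 ?sqr_ge0// ltW ?warp_gt0.
Qed.

(** The coefficient of [dt^2] is 1, so there is no loss; this confines a curve to a slab before
    [velocity_le] is applied to the other coordinates. *)
Lemma velocity0_le c t : `|velocity c t 0| <= speed g c t.
Proof.
rewrite speedE -sqrtr_sqr ler_wsqrtr// (bigD1 0)//= warp0// mul1r.
rewrite lerDl; apply: sumr_ge0 => i _.
by rewrite mulr_ge0 ?sqr_ge0// ltW ?warp_gt0.
Qed.

Section one_curve.
Variable c : R -> M.
Hypothesis cC1 : C1_curve c.
Let cj j : R -> R := fun t => (c t : 'rV[R]_m.+1) 0 j.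

Let c_cont (t : R) : t \in `[0, 1] -> {for t, continuous (c : R -> 'rV[R]_m.+1)}.
Proof. by move=> /cC1[]. Qed.

Let c_derivable (t : R) : t \in `[0, 1] -> derivable (c : R -> 'rV[R]_m.+1) t 1.
Proof.
move=> t01; have [_ h] := cC1 t01; have [dc _] := h tt I.
exact: (nbhs_singleton dc).
Qed.

Let velocity_cont (t : R) j : t \in `[0, 1] -> {for t, continuous (velocity c ^~ j)}.
Proof.
move=> t01; have [_ h] := cC1 t01; have [_ {}h] := h tt I.
apply: (@continuous_comp _ _ _ (derive1 (c : R -> 'rV[R]_m.+1)) (fun x : 'rV[R]_m.+1 => x 0 j)).
  exact: h.
exact: continuous_coord.
Qed.

Let cj_cont (t : R) j : t \in `[0, 1] -> {for t, continuous (cj j)}.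
Proof.
move=> t01; apply: (@continuous_comp _ _ _ (c : R -> 'rV[R]_m.+1) (fun x : 'rV[R]_m.+1 => x 0 j)).
  exact: c_cont.
exact: continuous_coord.
Qed.

Let cj_derive (t : R) j : t \in `[0, 1] -> is_derive t 1 (cj j) (velocity c t j).
Proof.
move=> /c_derivable dc; split; first exact: (derivable_mxP _ _ _).1 dc 0 j.
by rewrite /velocity derive1E derive_mx// mxE.
Qed.

Let speed_cont (t : R) : t \in `[0, 1] -> {for t, continuous (speed g c)}.
Proof.
move=> t01.
have -> : speed g c = Num.sqrt \o (fun t => \sum_j warp a j (c t) * velocity c t j ^+ 2).
  by apply/funext => s; rewrite speedE.
apply: continuous_comp; last exact: sqrt_continuous.
have wc j : {for t, continuous (fun t => warp a j (c t))}.
  apply: (@continuous_comp _ _ _ (c : R -> 'rV[R]_m.+1) (warp a j)); first exact: c_cont.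
  by apply: differentiable_continuous; rewrite warpE; exact: differentiable_expt.
apply: (@continuous_sum R R _ _ (fun j t => warp a j (c t) * velocity c t j ^+ 2) t) => j.
apply: (continuousM (wc j)).
exact: (continuous_at_sqr (@velocity_cont t j t01)).
Qed.

Let within_itv (D : set R) (f : R -> R) : (forall t, D t -> {for t, continuous f}) ->
  {within D, continuous f}.
Proof. by move=> cf; apply: continuous_in_subspaceT => t /[!inE]; exact: cf. Qed.

Lemma measurable_speed :
  measurable_fun (`[0, 1]%classic : set R) (fun t => (speed g c t)%:E).
Proof.
apply/measurable_EFinP; apply: subspace_continuous_measurable_fun => //.
by apply: within_itv => t Jt; exact: speed_cont.
Qed.

(** The intermediate time [s] is there because the bound on the [t]-coordinate is needed all along
    the curve, not only at its end. *)
Lemma le_curve_length j s k : s \in `[0, 1] -> 0 <= k ->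
  (forall t, t \in `[0, s] -> `|velocity c t j| <= k * speed g c t) ->
  (`|cj j s - cj j 0|%:E <= k%:E * curve_length g c)%E.
Proof.
move=> s01 k0 vk; have := s01; rewrite in_itv/= => /andP[s0 s1].
have [<-|s_gt0] := eqVneq 0 s.
  by rewrite subrr normr0 mule_ge0// ?lee_fin// curve_length_ge0.
have {s_gt0}sp : 0 < s by rewrite lt_neqAle s_gt0.
have sub t : t \in `[0, s] -> t \in `[0, 1].
  by rewrite !in_itv/= => /andP[-> ts]; rewrite (le_trans ts).
pose I : set R := `[0, s]%classic.
have cv : {within I, continuous (velocity c ^~ j)}.
  by apply: within_itv => t It; apply: velocity_cont; exact: sub.
have dcj : derivable_oo_LRcontinuous (cj j) 0 s.
  split.
  - move=> t ts; have [] // := @cj_derive t j.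
    by apply: sub; exact: subset_itv_oo_cc ts.
  - by apply: cvg_at_right_filter; apply: cj_cont; rewrite in_itv/= lexx ler01.
  - by apply: cvg_at_left_filter; exact: cj_cont.
have FTC : (\int[mu]_(t in I) (velocity c t j)%:E = (cj j s)%:E - (cj j 0)%:E)%E.
  apply: continuous_FTC2 => // t ts; rewrite derive1E.
  have [] // := @cj_derive t j; by apply: sub; exact: subset_itv_oo_cc ts.
have mI : measurable I by exact: measurable_itv.
have mv : measurable_fun I (fun t => (velocity c t j)%:E).
  by apply/measurable_EFinP; apply: subspace_continuous_measurable_fun.
pose J : set R := `[0, 1]%classic.
have mJ : measurable J by exact: measurable_itv.
have ms : measurable_fun J (fun t => (speed g c t)%:E) by exact: measurable_speed.
have IJ : I `<=` J by exact: sub.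
rewrite -[leLHS]/(`|(cj j s)%:E - (cj j 0)%:E|)%E -FTC.
have h0 := le_abse_integral mu mI mv.
apply: le_trans h0 _.
have h1 : (\int[mu]_(t in I) `|(velocity c t j)%:E| <=
           \int[mu]_(t in I) (k%:E * (speed g c t)%:E))%E.
  apply: ge0_le_integral => //.
  - exact: measurableT_comp.
  - by apply: measurable_funeM; exact: measurable_funS ms.
apply: le_trans h1 _.
rewrite ge0_integralZl//; last 2 first.
- exact: measurable_funS ms.
- by move=> t _; rewrite lee_fin speed_ge0.
apply: lee_wpmul2l; first by rewrite lee_fin.
apply: ge0_subset_integral => //.
by move=> t _; rewrite lee_fin speed_ge0.
Qed.

End one_curve.
End curves.

Section distances.
Context {R : realType} {m : nat}.
Variable a : 'I_m.+1 -> R.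
Hypothesis a0 : a 0 = 0.
Local Notation M := (rV_manifold R m).
Local Notation g := (solv_metric a).
Local Notation mu := (@lebesgue_measure R).
Local Notation E := (exponent_bound a).
Implicit Types (x y z : 'rV[R]_m.+1).

Lemma norm_le_dist (u v l b : R) : `|v - u| <= l -> `|u| + l <= b -> `|v| <= b.
Proof.
move=> vu ub; apply: le_trans ub; rewrite -[v in leLHS](subrK u) addrC.
by rewrite (le_trans (ler_normD _ _))// lerD2l.
Qed.

(** Two stages: [t] moves by at most [l], which keeps the curve in [|t| <= b]; there each component
    of the velocity is at most [expR (E * b)] times the speed. *)
Lemma curve_le (c : R -> M) (l b : R) : C1_curve c -> curve_length g c = l%:E ->
  `|(c 0 : 'rV[R]_m.+1) 0 0| + l <= b ->
  `|(c 1 : 'rV[R]_m.+1) 0 0 - (c 0 : 'rV[R]_m.+1) 0 0| <= l /\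
  forall j, `|(c 1 : 'rV[R]_m.+1) 0 j - (c 0 : 'rV[R]_m.+1) 0 j| <= expR (E * b) * l.
Proof.
move=> cC1 cl cb.
have c0l s : s \in `[0, 1] -> `|(c s : 'rV[R]_m.+1) 0 0 - (c 0 : 'rV[R]_m.+1) 0 0| <= l.
  move=> s01; have := @le_curve_length R m a c cC1 0 s 1 s01 ler01.
  rewrite mul1e cl lee_fin; apply=> t _; rewrite mul1r; exact: velocity0_le.
have i1 : 1 \in `[0, 1 : R] by rewrite in_itv/= lexx ler01.
split=> [|j]; first exact: c0l.
have := @le_curve_length R m a c cC1 j 1 (expR (E * b)) i1 (expR_ge0 _).
rewrite cl -EFinM lee_fin; apply=> t t01; apply: velocity_le.
exact: norm_le_dist (c0l _ t01) cb.
Qed.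

(** Induction on the chain: each piece preserves the inequality [|t| + remaining length <= b], so
    the same factor [expR (E * b)] serves for all pieces. *)
Lemma chain_le (s : seq (R -> M)) (x y : M) (l b : R) : joins x s y ->
  (\sum_(c <- s) curve_length g c <= l%:E)%E ->
  `|(x : 'rV[R]_m.+1) 0 0| + l <= b ->
  `|(y : 'rV[R]_m.+1) 0 0 - (x : 'rV[R]_m.+1) 0 0| <= l /\
  forall j, `|(y : 'rV[R]_m.+1) 0 j - (x : 'rV[R]_m.+1) 0 j| <= expR (E * b) * l.
Proof.
elim: s x l => [|c s IHs] x l /=.
  move=> -> ; rewrite big_nil lee_fin => l0 _.
  by split=> [|j]; rewrite subrr normr0// mulr_ge0 ?expR_ge0.
move=> [cC1 c0 js]; rewrite big_cons => sl xb.
have s0 : (0 <= \sum_(c <- s) curve_length g c)%E.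
  by apply: sume_ge0 => *; exact: curve_length_ge0.
have cl0 := curve_length_ge0 a c.
have cf : curve_length g c \is a fin_num.
  rewrite ge0_fin_numE//; apply: le_lt_trans (ltry l).
  by apply: le_trans sl; rewrite leeDl.
move: cl0 sl; rewrite -(fineK cf) lee_fin; set k := fine _ => k0 sl.
have sl' : (\sum_(c <- s) curve_length g c <= (l - k)%:E)%E.
  by rewrite EFinB leeBrDl.
have kl : k <= l by rewrite -subr_ge0 -lee_fin (le_trans s0).
have ck : curve_length g c = k%:E by rewrite fineK.
have xk : `|(c 0 : 'rV[R]_m.+1) 0 0| + k <= b.
  by rewrite c0; apply: le_trans xb; rewrite lerD2l.
have [h0 hj] := curve_le cC1 ck xk.
have c1b : `|(c 1 : 'rV[R]_m.+1) 0 0| + (l - k) <= b.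
  have c1k : `|(c 1 : 'rV[R]_m.+1) 0 0| <= `|x 0 0| + k by apply: norm_le_dist h0 _; rewrite c0.
  by apply: (le_trans (lerD c1k (lexx (l - k)))); rewrite -addrA subrKC.
have [h0' hj'] := IHs _ _ js sl' c1b.
rewrite -c0; split=> [|j].
  rewrite -(subrKA ((c 1 : 'rV[R]_m.+1) 0 0)) (le_trans (ler_normD _ _))//.
  by rewrite -[leRHS](subrK k) lerD.
rewrite -(subrKA ((c 1 : 'rV[R]_m.+1) 0 j)) (le_trans (ler_normD _ _))//.
by rewrite -[l in leRHS](subrK k) mulrDr lerD.
Qed.

Lemma geodesic_dist_lt_coord (x y : M) (l b : R) : (geodesic_dist g x y < l%:E)%E ->
  `|(x : 'rV[R]_m.+1) 0 0| + l <= b ->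
  `|(y : 'rV[R]_m.+1) 0 0 - (x : 'rV[R]_m.+1) 0 0| <= l /\
  forall j, `|(y : 'rV[R]_m.+1) 0 j - (x : 'rV[R]_m.+1) 0 j| <= expR (E * b) * l.
Proof.
move=> /ereal_inf_lt[_ [s js <-]] sl; exact: chain_le js (ltW sl).
Qed.

Lemma geodesic_dist_ge0 (x y : M) : (0 <= geodesic_dist g x y)%E.
Proof.
apply: le_ereal_inf_tmp => _ [s js <-].
by apply: sume_ge0 => *; exact: curve_length_ge0.
Qed.

Lemma joins_cat (s1 s2 : seq (R -> M)) (x y z : M) :
  joins x s1 y -> joins y s2 z -> joins x (s1 ++ s2) z.
Proof.
elim: s1 x => [|c s1 IHs] x /=; first by move=> ->.
by move=> [cC1 c0 js1] js2; split=> //; exact: IHs.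
Qed.

(** Triangle inequality by concatenation of chains; with strict real bounds, the chains are read off
    directly from the infima. *)
Lemma dist_to_lt (x y : M) (A : set M) (e l : R) :
  (geodesic_dist g x y < e%:E)%E -> (dist_to g y A < l%:E)%E ->
  (dist_to g x A < (e + l)%:E)%E.
Proof.
move=> /ereal_inf_lt[_ [s1 js1 <-]] s1e /ereal_inf_lt[_ [z Az <-]].
move=> /ereal_inf_lt[_ [s2 js2 <-]] s2l.
apply: (@le_lt_trans _ _ (geodesic_dist g x z)).
  by apply: ereal_inf_lbound; exists z.
apply: (@le_lt_trans _ _ (\sum_(c <- s1 ++ s2) curve_length g c)%E).
  by apply: ereal_inf_lbound; exists (s1 ++ s2) => //; exact: joins_cat js2.
by rewrite big_cat EFinD lteD.
Qed.

Lemma dist_to_mem (x : M) (A : set M) : A x -> (dist_to g x A <= 0)%E.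
Proof.
move=> Ax; apply: (@le_trans _ _ (geodesic_dist g x x)).
  by apply: ereal_inf_lbound; exists x.
by apply: ereal_inf_lbound; exists [::] => //; rewrite big_nil.
Qed.

End distances.

Section rV_norm.
Context {R : realType} {n : nat}.
Implicit Types v : 'rV[R]_n.

Lemma coord_le_norm v j : `|v 0 j| <= `|v|.
Proof.
rewrite [leRHS]/Num.Def.normr/= mx_normrE.
exact: le_trans (le_bigmax _ _ (ord0, j)).
Qed.

Lemma rV_norm_le v e : 0 <= e -> (forall j, `|v 0 j| <= e) -> `|v| <= e.
Proof.
move=> e0 ve; rewrite [leLHS]/Num.Def.normr/= mx_normrE.
by apply: bigmax_le => // -[i j] _; rewrite ord1.
Qed.

End rV_norm.

Section segments.
Context {R : realType} {m : nat}.
Variable a : 'I_m.+1 -> R.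
Hypothesis a0 : a 0 = 0.
Local Notation M := (rV_manifold R m).
Local Notation g := (solv_metric a).
Local Notation E := (exponent_bound a).
Implicit Types (x y : 'rV[R]_m.+1).

Definition segment x y (t : R) : 'rV[R]_m.+1 := x + t *: (y - x).

Lemma is_derive_segment x y (t : R) : is_derive t 1 (segment x y) (y - x).
Proof.
have h : derivable (@id 'rV[R]_m.+1) (x + t *: (y - x)) (y - x) by exact: derivable_id.
by have := is_derive_line h; rewrite derive_id.
Qed.

Lemma C1_segment x y : C1_curve (segment x y : R -> M).
Proof.
move=> t _; split.
  apply: differentiable_continuous; apply/derivable1_diffP.
  by have [] := is_derive_segment x y t.
move=> i _; split.
  by apply/nbhs_ballP; exists 1 => //= s _; have [] := is_derive_segment x y s.
have -> : derive1 (coord i \o (segment x y : R -> M)) = cst (y - x).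
  apply/funext => s; rewrite derive1E.
  by have [_] := is_derive_segment x y s.
exact: cst_continuous.
Qed.

Definition lipschitz_constant (b : R) : R := m.+1%:R * expR (E * b).

Lemma lipschitz_constant_gt0 b : 0 < lipschitz_constant b.
Proof. by rewrite mulr_gt0 ?expR_gt0 ?ltr0n. Qed.

(** The coordinate segment stays in [|t| <= b], where every coefficient is at most [e^{2 E b}]. Its
    speed is bounded crudely, with the factor [m.+1] in place of its square root. *)
Lemma geodesic_dist_le x y b : `|x 0 0| <= b -> `|y 0 0| <= b ->
  (geodesic_dist g (x : M) (y : M) <= (lipschitz_constant b * `|y - x|)%:E)%E.
Proof.
move=> xb yb; pose c : R -> M := segment x y.
apply: (@le_trans _ _ (curve_length g c)).
  apply: ereal_inf_lbound; exists [:: c]; last by rewrite big_seq1.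
  split; first exact: C1_segment.
    by rewrite /c /segment scale0r addr0.
  by rewrite /= /c /segment scale1r addrC subrK.
pose L := lipschitz_constant b * `|y - x|.
have L0 : 0 <= L by rewrite mulr_ge0// ltW ?lipschitz_constant_gt0.
apply: (@le_trans _ _ (\int[lebesgue_measure]_(t in `[0%R, 1%R]) L%:E)%E); last first.
  by rewrite integral_cst//= lebesgue_measure_itv/= lte_fin ltr01 sube0 mule1.
apply: ge0_le_integral => //.
- by move=> t _; rewrite lee_fin speed_ge0.
- by apply: measurable_speed; exact: C1_segment.
move=> t; rewrite /= in_itv/= => /andP[t0 t1]; rewrite lee_fin speedE.
rewrite -(ger0_norm L0) -sqrtr_sqr ler_wsqrtr//.
have ctb : `|(c t : 'rV[R]_m.+1) 0 0| <= b.
  have -> : (c t : 'rV[R]_m.+1) 0 0 = (1 - t) * x 0 0 + t * y 0 0.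
    by rewrite /c /segment !mxE; ring.
  rewrite (le_trans (ler_normD _ _))// !normrM ger0_norm ?subr_ge0// [`|t|]ger0_norm//.
  have -> : b = (1 - t) * b + t * b by ring.
  by rewrite lerD// ler_wpM2l// subr_ge0.
have vj j : warp a j (c t) * velocity c t j ^+ 2 <= (expR (E * b) * `|y - x|) ^+ 2.
  rewrite exprMn; apply: ler_pM; rewrite ?sqr_ge0// ?(ltW (warp_gt0 _ _ _))//.
    rewrite -expRM_natl /warp ler_expR.
    have := exponent_le a j ctb; rewrite ler_norml => /andP[_ h]; lra.
  rewrite -[leLHS]real_normK ?num_real//; apply: lerXn2r; rewrite ?nnegrE//.
  have -> : velocity c t j = (y - x) 0 j; last exact: coord_le_norm.
  rewrite /velocity; congr (fun_of_matrix _ 0 j).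
  by rewrite derive1E; have [_] := is_derive_segment x y t.
apply: (@le_trans _ _ (\sum_(j < m.+1) (expR (E * b) * `|y - x|) ^+ 2)).
  exact: ler_sum.
rewrite sumr_const card_ord -[leLHS]mulr_natl /L /lipschitz_constant -mulrA [leRHS]exprMn.
rewrite ler_wpM2r ?sqr_ge0// -natrX ler_nat.
by rewrite expnS expn1 leq_pmull.
Qed.

(** Both orders of the arguments are recorded: [dist_to_gt_near] uses the first and
    [dist_to_closure] the second. *)
Lemma geodesic_dist_near x (e : R) : 0 < e ->
  \forall y \near x, (geodesic_dist g (x : M) (y : M) < e%:E)%E /\
                     (geodesic_dist g (y : M) (x : M) < e%:E)%E.
Proof.
(* Points at norm distance less than 1 from [x] share the slab [|t| <= b], hence the Lipschitz
   constant [L]. *)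
move=> e0; pose b : R := `|x 0 0| + 1; pose L := lipschitz_constant b.
have L0 : 0 < L by exact: lipschitz_constant_gt0.
have d0 : 0 < Num.min 1 (e / L) by rewrite lt_min ltr01 divr_gt0.
have xb : `|x 0 0| <= b by rewrite lerDl.
near=> y.
have : `|x - y| < Num.min 1 (e / L) by near: y; exact: cvgr_dist_lt.
rewrite lt_min => /andP[xy1 xye].
have yb : `|y 0 0| <= b.
  rewrite -[y 0 0](subrK (x 0 0)) addrC (le_trans (ler_normD _ _))// lerD2l distrC.
  by have := coord_le_norm (x - y) 0; rewrite !mxE => h; exact: le_trans (ltW xy1).
have xye' : ((L * `|x - y|)%:E < e%:E)%E.
  by rewrite lte_fin mulrC -ltr_pdivlMr.
split; last exact: le_lt_trans (geodesic_dist_le yb xb) _.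
by apply: le_lt_trans (geodesic_dist_le xb yb) _; rewrite distrC.
Unshelve. all: by end_near. Qed.

End segments.

(** * Completeness and the two domains *)

Section completeness.
Context {R : realType} {m : nat}.
Variable a : 'I_m.+1 -> R.
Hypothesis a0 : a 0 = 0.
Local Notation M := (rV_manifold R m).
Local Notation g := (solv_metric a).
Local Notation E := (exponent_bound a).

(** A Cauchy sequence has bounded [t], so its coordinates are Cauchy in [R]; their limit is a limit
    for the geodesic distance because that distance is locally bounded by the norm. *)
Lemma complete_solv : complete_metric g.
Proof.
move=> u; pose v : nat -> 'rV[R]_m.+1 := u => cu.
have [N1 hN1] := cu 1 ltr01.
pose b : R := `|v N1 0 0| + 1.
have vb k : (N1 <= k)%N -> `|v k 0 0| <= b.
  move=> Nk; have [+ _] := geodesic_dist_lt_coord a0 (hN1 N1 k (leqnn _) Nk) (lexx b).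
  by move=> h; apply: norm_le_dist h _.
pose K := expR (E * (b + 1)).
have K0 : 0 < K by exact: expR_gt0.
have cv j : cvgn (fun k => v k 0 j).
  apply/cauchy_cvgP; apply: cauchy_exP => e e0.
  (* The minimum with 1 keeps [|t|] plus the distance below [b + 1], the bound built into [K]. *)
  have d0 : 0 < Num.min 1 (e / (2 * K)).
    by rewrite lt_min ltr01 divr_gt0// mulr_gt0.
  have [N hN] := cu _ d0.
  exists (v (maxn N N1) 0 j); exists (maxn N N1) => // k /= Nk.
  have d := hN (maxn N N1) k (leq_maxl _ _) (leq_trans (leq_maxl _ _) Nk).
  have [//|_ /(_ j) h] := geodesic_dist_lt_coord a0 d (b := b + 1).
    by rewrite lerD ?vb ?leq_maxr// ge_min lexx.
  rewrite /ball/= distrC; apply: le_lt_trans h _.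
  apply: (@le_lt_trans _ _ (K * (e / (2 * K)))).
    by rewrite ler_pM2l// ge_min lexx orbT.
  have -> : K * (e / (2 * K)) = e / 2 by field; rewrite lt0r_neq0.
  by rewrite ltr_pdivrMr// ltr_pMr// ltr1n.
pose x : 'rV[R]_m.+1 := \row_j limn (fun k => v k 0 j).
pose b' : R := b + `|x 0 0|.
have b0 : 0 <= b by rewrite addr_ge0.
pose L := lipschitz_constant a b'.
have L0 : 0 < L by exact: lipschitz_constant_gt0.
have nx : `|x - v k| @[k --> \oo] --> (0 : R).
  apply/cvgrPdist_le => e e0.
  have : \forall k \near \oo, forall j, `|x 0 j - v k 0 j| <= e.
    apply: filter_forall => j.
    have /cvgrPdist_le/(_ e e0) := cv j.
    by rewrite /x mxE.
  apply: filterS => k h; rewrite sub0r normrN normr_id.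
  by apply: rV_norm_le => [|j]; [exact: ltW|have := h j; rewrite !mxE].
exists x.
apply: (@squeeze_cvge _ _ _ _ (cst 0%E) _ (fun k => (L * `|x - v k|)%:E)).
- exists N1 => // k /= Nk; rewrite geodesic_dist_ge0/=.
  apply: geodesic_dist_le; last by rewrite lerDr.
  by rewrite (le_trans (vb _ Nk))// lerDl.
- exact: cvg_cst.
- apply/fine_cvgP; split; first exact: nearW.
  rewrite -(mulr0 L); apply: cvgM; [exact: cvg_cst|exact: nx].
Qed.

End completeness.

Section domains.
Context {R : realType} {m : nat}.
Variable a : 'I_m.+1 -> R.
Hypothesis a0 : a 0 = 0.
Local Notation M := (rV_manifold R m).
Local Notation g := (solv_metric a).
Local Notation E := (exponent_bound a).
Implicit Types (x y : 'rV[R]_m.+1) (p q : R).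

Lemma slab_convex p q x y (t : R) : slab m p q x -> slab m p q y -> t \in `[0, 1] ->
  slab m p q (x + t *: (y - x)).
Proof.
rewrite in_itv/= => -[x0 xS] [y0 yS] /andP[t0 t1].
have H (c : R) j : `|x 0 j| < c -> `|y 0 j| < c -> `|(x + t *: (y - x)) 0 j| < c.
  move=> xc yc; have -> : (x + t *: (y - x)) 0 j = (1 - t) * x 0 j + t * y 0 j.
    by rewrite !mxE; ring.
  rewrite (le_lt_trans (ler_normD _ _))// !normrM ger0_norm ?subr_ge0// [`|t|]ger0_norm//.
  have [->|tn0] := eqVneq t 0; first by rewrite subr0 mul1r mul0r addr0.
  have tp : 0 < t by rewrite lt_neqAle eq_sym tn0.
  have -> : c = (1 - t) * c + t * c by ring.
  by rewrite ler_ltD ?ltr_pM2l// ler_wpM2l ?subr_ge0// ltW.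
by split=> [|j]; exact: H.
Qed.

Lemma slab_connected p q : connected (slab m p q).
Proof. by apply: convex_connected => x y t; exact: slab_convex. Qed.

Lemma slab_bounded p q : 0 < p -> 0 < q -> metric_bounded g (slab m p q : set M).
Proof.
move=> p0 q0; pose N : R := p + q.
exists (lipschitz_constant a p * (2 * N)) => x y xs ys.
have [x0 xS] := xs; have [y0 yS] := ys.
have h := @geodesic_dist_le R m a x y p (ltW x0) (ltW y0).
apply: le_trans h _.
have nN z : slab m p q z -> `|z| <= N.
  move=> [z0 zS]; apply: rV_norm_le => [|j]; first by rewrite addr_ge0 ?ltW.
  case: (unliftP ord0 j) => [k ->|->].
    by apply: le_trans (ltW (zS k)) _; rewrite lerDr ltW.
  by apply: le_trans (ltW z0) _; rewrite lerDl ltW.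
rewrite lee_fin ler_pM2l ?lipschitz_constant_gt0// (le_trans (ler_normB _ _))//.
by rewrite mulr_natl mulr2n lerD// nN.
Qed.

Section dist_sets.
Variables (A : set M) (r : R).

Lemma dist_to_gt_near x : (r%:E < dist_to g (x : M) A)%E ->
  \forall y \near x, (r%:E < dist_to g (y : M) A)%E.
Proof.
move=> rx.
(* Half the margin is given up to the triangle inequality; an infinite distance allows any [e]. *)
have [e e0 re] : exists2 e : R, 0 < e & ((r + 2 * e)%:E <= dist_to g (x : M) A)%E.
  move: rx; case: (dist_to g (x : M) A) => [s| |] //=.
    rewrite lte_fin => rs; exists ((s - r) / 2); first by rewrite divr_gt0// subr_gt0.
    by rewrite lee_fin mulrC divfK// subrKC.
  by exists 1 => //; rewrite leey.
have := geodesic_dist_near a x e0; apply: filterS => y [xy _].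
rewrite ltNge; apply/negP => yr.
have yr' : (dist_to g (y : M) A < (r + e)%:E)%E.
  by apply: le_lt_trans yr _; rewrite lte_fin ltrDl.
have := dist_to_lt xy yr'; rewrite ltNge => /negP; apply.
apply: le_trans re; rewrite lee_fin; lra.
Qed.

Lemma dist_to_closure x (B : set 'rV[R]_m.+1) :
  (forall y, B y -> (r%:E <= dist_to g (y : M) A)%E) -> closure B x ->
  (r%:E <= dist_to g (x : M) A)%E.
Proof.
move=> Br Bx; rewrite leNgt; apply/negP => xr.
have [s xs sr] : exists2 s : R, (dist_to g (x : M) A < s%:E)%E & s < r.
  have := xr; have : (0 <= dist_to g (x : M) A)%E.
    apply: le_ereal_inf_tmp => _ [y _ <-]; exact: geodesic_dist_ge0.
  case: (dist_to g (x : M) A) => [s| |] //= _.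
  rewrite lte_fin => sr; exists ((s + r) / 2); last by lra.
  by rewrite lte_fin; lra.
have e0 : 0 < r - s by rewrite subr_gt0.
have [y [By [_ yx]]] := Bx _ (geodesic_dist_near a x e0).
have := dist_to_lt yx xs; rewrite subrK ltNge => /negP; apply.
exact: Br.
Qed.

End dist_sets.

Section component.
Variables (O : set 'rV[R]_m.+1) (r : R) (x0 : 'rV[R]_m.+1).
Hypothesis oO : open O.
Hypothesis r0 : 0 < r.
Let f x := dist_to g (x : M) (boundary (O : set M)).
Let U : set 'rV[R]_m.+1 := O `&` [set x | (r%:E < f x)%E].

(* Omega_1 is only required to be connected, so a connected component is taken rather than
   the whole superlevel set, whose connectedness would need the exact distance. *)
Definition deep_component : set 'rV[R]_m.+1 := connected_component U x0.
Local Notation O1 := deep_component.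

Lemma open_deep : open U.
Proof.
rewrite openE => x [Ox xr]; rewrite /interior.
have nO : nbhs x O by exact: open_nbhs_nbhs.
by near=> y; split; near: y => //; exact: dist_to_gt_near.
Unshelve. all: by end_near. Qed.

Let component_absorbs (B : set 'rV[R]_m.+1) y : connected B -> B `<=` U -> B y ->
  O1 y -> B `<=` O1.
Proof.
move=> cB BU By Dy z Bz.
by apply: connected_component_trans Dy _; exact: connected_component_max By BU cB _ Bz.
Qed.

Let U_ball x : U x -> exists2 e : R, 0 < e & ball x e `<=` U.
Proof.
move=> Ux; have /nbhs_ballP[e /= e0 eU] : nbhs x U by exact: (open_nbhs_nbhs (conj open_deep Ux)).
by exists e.
Qed.

Lemma deep_component_sub : O1 `<=` O.
Proof. by move=> x /connected_component_sub[]. Qed.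

Lemma deep_component_open : open O1.
Proof.
rewrite openE => x Dx; have [e epos eU] := U_ball (connected_component_sub Dx).
apply/nbhs_ballP; exists e => //.
by apply: (component_absorbs (@ball_connected _ _ x e) eU _ Dx); exact: ballxx.
Qed.

(** The distance is at least [r] by passing to the closure, so [x] lies in [O], as boundary points
    of [O] are at distance 0. If it exceeded [r], a ball around [x] inside [U] would meet the
    component and be absorbed by it, making [x] an interior point. *)
Lemma boundary_deep_component x : boundary (O1 : set M) x ->
  dist_to g (x : M) (boundary (O : set M)) = r%:E.
Proof.
move=> [clx nx]; rewrite -/(f x).
have rx : (r%:E <= f x)%E.
  by apply: dist_to_closure clx => y /connected_component_sub[_ /ltW].
have Ox : O x.
  have clO : closure O x by apply: closure_subset clx; exact: deep_component_sub.
  apply: contrapT => nO; have : boundary (O : set M) x.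
    by split=> //; rewrite (interior_id _).1.
  by move=> /(@dist_to_mem _ _ a) h; have := le_trans rx h; rewrite lee_fin leNgt r0.
apply/eqP; rewrite eq_le rx andbT leNgt; apply/negP => rfx.
have [e epos eU] := U_ball (conj Ox rfx).
have [y [Dy xy]] := clx _ (nbhsx_ballx x e epos).
apply: nx; apply/nbhs_ballP; exists e => //.
exact: (component_absorbs (@ball_connected _ _ x e) eU xy Dy).
Qed.

End component.

Section well.
Variable r : R.
Hypothesis r0 : 0 < r.

(** From [|t| < 1], a chain of length less than [r + 1] stays in [|t| <= r + 2] and moves each [x_j]
    by at most [(r + 1) * expR (E * (r + 2))]. The width is twice this, so that such a chain
    starting in [core] cannot reach the walls. *)
Definition well_width : R := 2 * (r + 1) * expR (E * (r + 2)).
Local Notation rho := well_width.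

Definition outer_domain : set 'rV[R]_m.+1 := slab m (r + 2) rho.
Definition inner_domain : set 'rV[R]_m.+1 := deep_component outer_domain r 0.
Definition core : set 'rV[R]_m.+1 := slab m 1 (rho / 2).

Lemma well_width_gt0 : 0 < rho.
Proof. by rewrite mulr_gt0 ?expR_gt0// mulr_gt0// addr_gt0. Qed.

Lemma core_sub : core `<=` outer_domain.
Proof.
have rpos := r0; move=> x [x0 xS]; split=> [|j]; first by rewrite (lt_trans x0)//; lra.
by rewrite (lt_trans (xS j))//; have := well_width_gt0; lra.
Qed.

(** The distance is even at least [r + 1]: a shorter chain from [core] ends inside the open box,
    hence not on its boundary. The extra 1 makes the inequality strict. *)
Lemma core_deep (x : M) : core x ->
  (r%:E < dist_to g x (boundary (outer_domain : set M)))%E.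
Proof.
have rpos := r0; move=> cx; apply: (@lt_le_trans _ _ (r + 1)%:E); first by rewrite lte_fin ltrDl.
apply: le_ereal_inf_tmp => _ [y by_ <-]; rewrite leNgt; apply/negP => d.
have [x0 xS] := cx.
have [|h0 hS] := geodesic_dist_lt_coord a0 d (b := r + 2); first by lra.
have [_ ny] := by_; apply: ny; rewrite (interior_id _).1; last exact: open_slab.
have tri (u v p q : R) : `|u| < p -> `|v - u| <= q -> `|v| < p + q.
  move=> up vu; rewrite -[v](subrK u) addrC (le_lt_trans (ler_normD _ _))//.
  exact: ltr_leD.
split=> [|j]; first by have := tri _ _ _ _ x0 h0; lra.
have := tri _ _ _ _ (xS j) (hS (lift ord0 j)); rewrite /well_width.
by move=> h; apply: lt_le_trans h _; rewrite le_eqVlt; apply/orP; left; apply/eqP; field.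
Qed.

Lemma core_inner : core `<=` inner_domain.
Proof.
have c0 : core 0.
  by split=> [|j]; rewrite mxE normr0// divr_gt0// well_width_gt0.
apply: connected_component_max => //; last exact: slab_connected.
by move=> x cx; split; [exact: core_sub|exact: core_deep].
Qed.

End well.
End domains.

(** * The first eigenvalue *)

Section L2_limit.
Context d (T : measurableType d) (R : realType) (mu : {measure set T -> \bar R}).
Variable D : set T.
Hypothesis mD : measurable D.
Implicit Types f h : T -> R.

Let sqr_ge0E f x : (0 <= (f x ^+ 2)%:E)%E.
Proof. by rewrite lee_fin sqr_ge0. Qed.

Let measurable_sqr f : measurable_fun D f -> measurable_fun D (fun x => (f x ^+ 2)%:E).
Proof. by move=> mf; apply/measurable_EFinP; exact: measurable_funX. Qed.

(** Young's inequality: the difference of the integrands is [s^-1 * (s * f + (f - h)) ^+ 2]. It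
    plays the role of the triangle inequality in [L^2] without square roots of possibly infinite
    integrals. *)
Lemma integral_sqr_le f h (s : R) : 0 < s -> measurable_fun D f -> measurable_fun D h ->
  (\int[mu]_(x in D) (h x ^+ 2)%:E <= (1 + s)%:E * \int[mu]_(x in D) (f x ^+ 2)%:E +
     (1 + s^-1)%:E * \int[mu]_(x in D) ((f x - h x) ^+ 2)%:E)%E.
Proof.
move=> s0 mf mh.
have mfh : measurable_fun D (fun x => f x - h x) by exact: measurable_funB.
have c1 : 0 <= 1 + s by rewrite addr_ge0// ltW.
have c2 : 0 <= 1 + s^-1 by rewrite addr_ge0// invr_ge0 ltW.
have m1 : measurable_fun D (fun x => ((1 + s)%:E * (f x ^+ 2)%:E)%E).
  by apply: measurable_funeM; exact: measurable_sqr.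
have m2 : measurable_fun D (fun x => ((1 + s^-1)%:E * ((f x - h x) ^+ 2)%:E)%E).
  by apply: measurable_funeM; exact: measurable_sqr.
have sM h' (c : R) : 0 <= c -> measurable_fun D h' ->
    (c%:E * \int[mu]_(x in D) (h' x ^+ 2)%:E = \int[mu]_(x in D) (c%:E * (h' x ^+ 2)%:E))%E.
  move=> c0 mh'; rewrite ge0_integralZl//; first by exact: measurable_sqr.
rewrite !sM//.
rewrite -ge0_integralD//; last 2 first.
- by move=> x _; rewrite mule_ge0 ?lee_fin// sqr_ge0.
- by move=> x _; rewrite mule_ge0 ?lee_fin// sqr_ge0.
apply: ge0_le_integral => //.
- exact: measurable_sqr.
- exact: emeasurable_funD.
move=> x _; rewrite -!EFinM -EFinD lee_fin -subr_ge0.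
suff -> : (1 + s) * f x ^+ 2 + (1 + s^-1) * (f x - h x) ^+ 2 - h x ^+ 2 =
    s^-1 * (s * f x + (f x - h x)) ^+ 2 by rewrite mulr_ge0 ?sqr_ge0// invr_ge0 ltW.
by field; rewrite lt0r_neq0.
Qed.

(** By contradiction: if the integral of [v ^+ 2] were below [k'], two Young inequalities around a
    late approximant would give [k <= (1 + s) ^+ 2 * k'] plus a small error. *)
Lemma L2_limit_le (k k' : R) (phi v : T -> R) (f u : nat -> T -> R) :
  0 < k' -> k' < k -> measurable_fun D phi -> measurable_fun D v ->
  (forall i, measurable_fun D (f i)) -> (forall i, measurable_fun D (u i)) ->
  (forall i, (k%:E * \int[mu]_(x in D) (f i x ^+ 2)%:E <= \int[mu]_(x in D) (u i x ^+ 2)%:E)%E) ->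
  (forall e, 0 < e -> \forall i \near \oo,
    (\int[mu]_(x in D) ((f i x - phi x) ^+ 2)%:E < e%:E)%E) ->
  (forall e, 0 < e -> \forall i \near \oo,
    (\int[mu]_(x in D) ((u i x - v x) ^+ 2)%:E < e%:E)%E) ->
  (\int[mu]_(x in D) (phi x ^+ 2)%:E = 1)%E ->
  (k'%:E <= \int[mu]_(x in D) (v x ^+ 2)%:E)%E.
Proof.
move=> k'0 k'k mphi mv mf mu_ ku fphi uv phi1.
rewrite leNgt; apply/negP => Vk'.
have k0 : 0 < k by exact: lt_trans k'k.
(* The gap [k - k'] is shared out: since [(1 + s) ^+ 2 <= 1 + 3 * s], this [s] costs at most half of
   it, and [e] is such that the error [c * e] is a quarter. *)
pose s := Num.min 1 ((k - k') / (6 * k')).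
have s0 : 0 < s by rewrite lt_min ltr01 divr_gt0 ?subr_gt0// mulr_gt0.
have s1 : s <= 1 by rewrite ge_min lexx.
have sk : 6 * k' * s <= k - k'.
  by rewrite mulrC -ler_pdivlMr ?mulr_gt0// ge_min lexx orbT.
pose c := (1 + s^-1) * ((1 + s) + k).
have c0 : 0 < c by rewrite mulr_gt0// !addr_gt0// invr_gt0.
pose e := (k - k') / (2 * c) / 2.
have e0 : 0 < e by rewrite !divr_gt0 ?subr_gt0// mulr_gt0.
have [i [fi ui]] : exists i, (\int[mu]_(x in D) ((f i x - phi x) ^+ 2)%:E < e%:E)%E /\
    (\int[mu]_(x in D) ((u i x - v x) ^+ 2)%:E < e%:E)%E.
  have [N1 _ h1] := fphi e e0; have [N2 _ h2] := uv e e0.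
  by exists (maxn N1 N2); split; [apply: h1; exact: leq_maxl|apply: h2; exact: leq_maxr].
have I0 (h : T -> R) : (0 <= \int[mu]_(x in D) (h x ^+ 2)%:E)%E.
  by apply: integral_ge0 => x _; exact: sqr_ge0E.
have A1 := integral_sqr_le s0 (mf i) mphi.
have A2 := integral_sqr_le s0 mv (mu_ i).
have vu : (\int[mu]_(x in D) ((v x - u i x) ^+ 2)%:E = \int[mu]_(x in D) ((u i x - v x) ^+ 2)%:E)%E.
  by apply: eq_integral => x _; rewrite -sqrrN opprB.
rewrite vu in A2; rewrite phi1 in A1.
have := ku i; move: (I0 (f i)) (I0 (u i)) (I0 v) A1 A2 fi ui Vk'.
have := I0 (fun x => f i x - phi x); have := I0 (fun x => u i x - v x).
move: (\int[mu]_(x in D) (f i x ^+ 2)%:E)%E (\int[mu]_(x in D) (u i x ^+ 2)%:E)%E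
  (\int[mu]_(x in D) (v x ^+ 2)%:E)%E (\int[mu]_(x in D) ((f i x - phi x) ^+ 2)%:E)%E
  (\int[mu]_(x in D) ((u i x - v x) ^+ 2)%:E)%E.
(* The strict upper bounds make [V], [P] and [Q] real; then [A2] makes [U] real and the inequality
   between [F] and [U] makes [F] real. *)
move=> F U [V| |] [P| |] [Q| |] //= Q0 P0 F0 U0 V0 A1 A2 Pe Qe Vk'.
move: U U0 A2 => [U| |] // U0 A2.
move: F F0 A1 => [F| |] // F0 A1; last first.
  by rewrite gt0_muley ?lte_fin// leye_eq.
move: Q0 P0 F0 U0 V0 A1 A2 Pe Qe Vk'.
rewrite -?EFinM -?EFinD -?EFinM !lee_fin !lte_fin => Q0 P0 F0 U0 V0 A1 A2 Pe Qe Vk' kFU.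
have h1 : k <= (1 + s) * U + k * (1 + s^-1) * P.
  rewrite -[leLHS]mulr1; apply: le_trans (ler_wpM2l (ltW k0) A1) _.
  rewrite mulrDr !mulrA lerD2r [k * _]mulrC -mulrA ler_wpM2l// addr_ge0// ltW//.
have h2 : k <= (1 + s) ^+ 2 * V + (1 + s) * (1 + s^-1) * Q + k * (1 + s^-1) * P.
  apply: le_trans h1 _; rewrite lerD2r.
  have -> : (1 + s) ^+ 2 * V + (1 + s) * (1 + s^-1) * Q =
    (1 + s) * ((1 + s) * V + (1 + s^-1) * Q) by ring.
  by rewrite ler_wpM2l// addr_ge0// ltW.
have s'0 : 0 < s^-1 by rewrite invr_gt0.
have h3 : (1 + s) * (1 + s^-1) * Q + k * (1 + s^-1) * P <= c * e.
  have -> : c * e = (1 + s) * (1 + s^-1) * e + k * (1 + s^-1) * e by rewrite /c; ring.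
  by apply: lerD; rewrite ler_wpM2l ?ltW// mulr_gt0 ?addr_gt0.
have h4 : c * e = (k - k') / 4 by rewrite /e; field; rewrite lt0r_neq0.
have h5 : (1 + s) ^+ 2 * V <= (1 + 3 * s) * k'.
  apply: ler_pM; [exact: sqr_ge0|exact: V0| |exact: ltW].
  rewrite -subr_ge0 (_ : _ - _ = s * (1 - s)); last by ring.
  by rewrite mulr_ge0 ?subr_ge0// ltW.
have : k <= (1 + 3 * s) * k' + (k - k') / 4.
  by rewrite -h4 (le_trans h2)// -addrA lerD.
have -> : (1 + 3 * s) * k' = k' + (6 * k' * s) / 2 by field.
lra.
Qed.

End L2_limit.

Section energy.
Context d (T : measurableType d) (R : realType) (mu : {measure set T -> \bar R}).
Variable D : set T.
Hypothesis mD : measurable D.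
Local Open Scope ereal_scope.

(** The integrand changes sign and the integral of [N] may be infinite, so linearity is applied to
    the nonnegative identity [Fp - S psi = c N + Fn]. The negative part has a finite integral, being
    at most [- S psi]. *)
Lemma integral_energy_ge (c S k : R) (N psi : T -> R) : (0 <= c)%R -> (S <= 0)%R ->
  measurable_fun D N -> measurable_fun D psi ->
  (forall x, 0 <= N x)%R -> (forall x, 0 <= psi x)%R ->
  k%:E <= \int[mu]_(x in D) (N x)%:E -> \int[mu]_(x in D) (psi x)%:E = 1 ->
  (c * k + S)%:E <= \int[mu]_(x in D) (c * N x + S * psi x)%:E.
Proof.
move=> c0 S0 mN mpsi N0 psi0 kN psi1.
have NS0 : (0 <= - S)%R by rewrite oppr_ge0.
pose F x : R := (c * N x + S * psi x)%R.
have mF : measurable_fun D F.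
  by apply: measurable_funD; apply: measurable_funM => //; exact: measurable_cst.
pose Fp x : R := Num.max (F x) 0%R; pose Fn x : R := Num.max (- F x)%R 0%R.
have mFp : measurable_fun D (EFin \o Fp).
  by apply/measurable_EFinP; apply: measurable_maxr; [exact: mF|exact: measurable_cst].
have mFn : measurable_fun D (EFin \o Fn).
  apply/measurable_EFinP; apply: measurable_maxr; last exact: measurable_cst.
  exact: measurableT_comp.
have Fp0 x : (0 <= Fp x)%R by rewrite le_max lexx orbT.
have Fn0 x : (0 <= Fn x)%R by rewrite le_max lexx orbT.
have Fpn x : (Fp x + - S * psi x = c * N x + Fn x)%R.
  have [h|/ltW h] := lerP 0%R (F x).
    have h' : (- F x <= 0)%R by rewrite oppr_le0.
    by rewrite /Fp /Fn (max_l h) (max_r h') /F; ring.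
  have h' : (0 <= - F x)%R by rewrite oppr_ge0.
  by rewrite /Fp /Fn (max_r h) (max_l h') /F; ring.
have FnS x : (Fn x <= - S * psi x)%R.
  by rewrite /Fn /F ge_max mulr_ge0// andbT; have := mulr_ge0 c0 (N0 x); lra.
have mEpsi (b : R) (f : T -> R) : measurable_fun D f -> measurable_fun D (fun x => (b * f x)%:E).
  by move=> mf; apply/measurable_EFinP; apply: measurable_funM => //; exact: measurable_cst.
have sc (b : R) (f : T -> R) : (0 <= b)%R -> measurable_fun D f -> (forall x, 0 <= f x)%R ->
    \int[mu]_(x in D) (b * f x)%:E = b%:E * \int[mu]_(x in D) (f x)%:E.
  move=> b0 mf f0; rewrite -ge0_integralZl//; last by move=> x _; rewrite lee_fin.
  exact/measurable_EFinP.
have Ip : 0 <= \int[mu]_(x in D) (Fp x)%:E by apply: integral_ge0 => x _; rewrite lee_fin.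
have In : 0 <= \int[mu]_(x in D) (Fn x)%:E by apply: integral_ge0 => x _; rewrite lee_fin.
have InS : \int[mu]_(x in D) (Fn x)%:E <= (- S)%:E.
  rewrite -[leRHS]mule1 -psi1 -sc//; apply: ge0_le_integral => //.
  - by move=> x _; rewrite lee_fin.
  - exact: mEpsi.
  - by move=> x _; rewrite lee_fin.
have eqI : \int[mu]_(x in D) (Fp x)%:E + (- S)%:E =
           c%:E * \int[mu]_(x in D) (N x)%:E + \int[mu]_(x in D) (Fn x)%:E.
  have addI (f h : T -> R) : measurable_fun D (EFin \o f) -> measurable_fun D (EFin \o h) ->
      (forall x, 0 <= f x)%R -> (forall x, 0 <= h x)%R ->
      \int[mu]_(x in D) (f x)%:E + \int[mu]_(x in D) (h x)%:E = \int[mu]_(x in D) (f x + h x)%:E.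
    by move=> mf mh f0 h0; rewrite -ge0_integralD// => x _; rewrite lee_fin.
  rewrite -[(- S)%:E]mule1 -psi1 -!sc// !addI//.
  - by apply: eq_integral => x _; rewrite Fpn.
  - exact: mEpsi.
  - by move=> x; rewrite mulr_ge0.
  - exact: mEpsi.
  - by move=> x; rewrite mulr_ge0.
have -> : \int[mu]_(x in D) (c * N x + S * psi x)%:E =
    \int[mu]_(x in D) (Fp x)%:E - \int[mu]_(x in D) (Fn x)%:E.
  rewrite integralE; congr (_ - _); apply: eq_integral => x _.
    by rewrite funeposE -EFin_max.
  by rewrite funenegE -EFinN -EFin_max.
have cN : (c * k)%:E <= c%:E * \int[mu]_(x in D) (N x)%:E.
  by rewrite EFinM lee_wpmul2l.
move: cN Ip In InS eqI => /=.
move: (c%:E * _) (\int[mu]_(x in D) (Fp x)%:E) (\int[mu]_(x in D) (Fn x)%:E).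
(* [Q] is real by the bound [- S]; if [P] is infinite, so is the difference to be bounded below. *)
move=> [y| |] [P| |] [Q| |] //= h1 h2 h3 h4.
  by move=> [h5]; rewrite -EFinB lee_fin; move: h1; rewrite lee_fin; lra.
by rewrite leey.
Qed.

End energy.

Section eigenvalue.
Context {R : realType} {m : nat}.
Variable a : 'I_m.+1 -> R.
Hypothesis a0 : a 0 = 0.
Local Notation M := (rV_manifold R m).
Local Notation g := (solv_metric a).
Local Notation beta := (\sum_j a j).

Definition solv_volume : {measure set (borel M) -> \bar R} := weighted_lebesgue beta.
Local Notation vol := solv_volume.

Lemma riemannian_volume_solv : riemannian_volume g vol.
Proof.
move=> i A mA _; have -> : coord i @` A = A by exact: image_id.
pose h (x : borel_rV R m.+1) : \bar R := ((\1_A x : R) * Num.sqrt (\det (solv_mx a x)))%:E.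
have hE x : h x = ((\1_A x : R) * weight beta x)%:E by rewrite /h det_solv_mx.
have mh : measurable_fun setT h.
  apply: (eq_measurable_fun (fun x => ((\1_A x : R) * weight beta x)%:E)).
    by move=> x _; rewrite hE.
  apply/measurable_EFinP; apply: measurable_funM; first exact: measurable_indic.
  exact: measurable_weight.
have h0 x : (0 <= h x)%E by rewrite lee_fin mulr_ge0// sqrtr_ge0.
rewrite -[RHS]/(lebesgue_integral_rV h) lebesgue_integral_rVE//.
rewrite /vol /weighted_lebesgue /= /with_density integral_mkcond.
by apply: eq_integral => x _; rewrite epatch_indic hE EFinM muleC.
Qed.

Lemma smooth_differentiable (f : 'rV[R]_m.+1 -> R) (s : seq 'I_m.+1) x :
  smooth_on ((@id 'rV[R]_m.+1) @` setT) f -> differentiable (foldr pderiv f s) x.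
Proof. by apply; exists x. Qed.

(** This is where the derivatives in the directions [x_j] are discarded: the component of index
    [(0, 0)] of the inverse metric is 1 and the other terms are nonnegative. *)
Lemma covector_norm2_ge (w : chart M -> M -> 'rV[R]_m.+1) (x : M) :
  (w tt x 0 0) ^+ 2 <= covector_norm2 g w x.
Proof.
rewrite /covector_norm2 quad_invmx_solv_mx (bigD1 0)//= warp0// invr1 mul1r.
by rewrite lerDl; apply: sumr_ge0 => j _; rewrite mulr_ge0 ?sqr_ge0// invr_ge0 ltW ?warp_gt0.
Qed.

Lemma measurable_covector_norm2 (D : set (borel M)) (w : chart M -> M -> 'rV[R]_m.+1) :
  measurable D ->
  (forall j, measurable_fun D (fun x : borel M => w tt x 0 j)) ->
  measurable_fun D (fun x : borel M => covector_norm2 g w x).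
Proof.
move=> mD mw.
have -> : (fun x : borel M => covector_norm2 g w x) =
    (fun x => \sum_j (warp a j x)^-1 * w tt x 0 j ^+ 2).
  by apply/funext => x; rewrite /covector_norm2 quad_invmx_solv_mx.
apply: measurable_sum => j; apply: measurable_funM; last exact: measurable_funX.
apply: measurable_funTS.
have -> : (fun x : borel M => (warp a j x)^-1) = expt 1 (- (2 * a j)).
  by apply/funext => x; rewrite /expt mul1r /warp -expRN -mulNr.
apply: continuous_borel_rV => x; apply: differentiable_continuous.
exact: differentiable_expt.
Qed.

(** The Hardy inequality of the test functions passes to the weak [t]-derivative [w tt x 0 0], at
    the price of a constant [k] below the Hardy constant. The scalar curvature is constant, so with
    [phi] normalised it contributes exactly itself. *)
Lemma eigenvalue_ge (p q k : R) : (2 < m.+1)%N -> 0 < p -> 0 < k ->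
  k < hardy_constant p beta ->
  ((@conformal_constant R m.+1 * k - (beta ^+ 2 + \sum_j a j ^+ 2))%:E <=
   first_eigenvalue g vol (slab m p q : set M))%E.
Proof.
move=> m2 p0 k0 kh; apply: le_ereal_inf_tmp.
move=> _ [phi [w [[mphi [cw mw] [f [ft fphi fw]]] phi1 ->]]].
pose A : set (borel M) := slab m p q.
have mA : measurable A by exact: measurable_slab.
have mw' j : measurable_fun A (fun x : borel M => w tt x 0 j).
  exact: (@measurable_funTS _ _ _ _ A _ (mw tt j)).
pose u i (x : 'rV[R]_m.+1) := pderiv 0 (f i) x.
have sm i (s : seq 'I_m.+1) x : differentiable (foldr pderiv (f i : 'rV[R]_m.+1 -> R) s) x.
  by apply: smooth_differentiable; have [h _] := ft i; exact: (h tt).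
have cf i : continuous (f i : 'rV[R]_m.+1 -> R).
  by move=> x; apply: differentiable_continuous; exact: (sm i [::]).
have cp i j : continuous (pderiv j (f i : 'rV[R]_m.+1 -> R)).
  by move=> x; apply: differentiable_continuous; exact: (sm i [:: j]).
have f0 i x : ~ A x -> f i x = 0.
  by move=> nAx; have [_ [K [_ KA Kf]]] := ft i; apply: Kf => /KA.
(* A point outside [A], even on its boundary, lies in the open complement of the compact support,
   where [f i] vanishes locally. *)
have u0 i x : ~ A x -> u i x = 0.
  move=> nAx; have [_ [K [cK KA Kf]]] := ft i.
  have cnK : open (~` K).
    by apply: closed_openC; exact: compact_closed (@manifold_hausdorff _ _ M) cK.
  have nKx : (~` K) x by move=> /KA.
  rewrite /u /pderiv -[RHS](derive_cst (0 : R) x (delta_mx 0 0)).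
  apply: near_eq_derive.
  by apply: filterS (open_nbhs_nbhs (conj cnK nKx)) => y /Kf.
have hardy i : ((hardy_constant p beta)%:E * \int[vol]_(x in A) (f i x ^+ 2)%:E <=
    \int[vol]_(x in A) (u i x ^+ 2)%:E)%E.
  have ext (h : M -> R) : (forall x, ~ A x -> h x = 0) ->
      (\int[vol]_(x in A) (h x ^+ 2)%:E = \int[vol]_x (h x ^+ 2)%:E)%E.
    move=> h0; rewrite integral_mkcond; apply: eq_integral => x _; rewrite patchE.
    by case: ifPn => // /negP; rewrite inE => /h0 ->; rewrite expr0n.
  rewrite (ext _ (f0 i)) (ext _ (u0 i)); apply: hardy_rV => //.
  - by move=> x; exact: (sm i [::]).
  - by move=> x px; apply: f0 => -[xp _]; move: px; rewrite leNgt xp.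
have mb (h : 'rV[R]_m.+1 -> R) : continuous h -> measurable_fun A (h : borel M -> R).
  by move=> ch; apply: measurable_funTS; exact: (continuous_borel_rV ch).
have wk : (k%:E <= \int[vol]_(x in A) ((w tt x 0 0) ^+ 2)%:E)%E.
  have toE (v : nat -> \bar R) : v i @[i --> \oo] --> 0%E -> forall e : R, 0 < e ->
      \forall i \near \oo, (v i < e%:E)%E.
    move=> v0 e e0; have n0 : nbhs (0%E : \bar R) [set y | (y < e%:E)%E].
      by apply: open_nbhs_nbhs; split; [exact: open_ereal_lt_ereal|rewrite /= lte_fin].
    exact: v0 _ n0.
  apply: (@L2_limit_le _ _ R vol A mA (hardy_constant p beta) k
    phi (fun x => w tt x 0 0) f u) => //.
  - by move=> i; apply: mb; exact: cf.
  - by move=> i; apply: mb; exact: cp.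
  - exact: toE.
  (* The [L^2] distance between the [t]-derivatives is dominated by the one between the full
     differentials, again by [covector_norm2_ge]. *)
  - move=> e e0; have := toE _ fw e e0; apply: filterS => i; apply: le_lt_trans.
    pose dw := fun j y => differential (f i) j y - w j y.
    have mdw j : measurable_fun A (fun x : borel M => dw tt x 0 j).
      rewrite (_ : (fun x => _) = fun x : borel M => pderiv j (f i) x - w tt x 0 j).
        by apply: measurable_funB => //; apply: mb; exact: cp.
      by apply/funext => x; rewrite /dw /differential !mxE.
    apply: ge0_le_integral => //.
    + by move=> x _; rewrite lee_fin sqr_ge0.
    + apply/measurable_EFinP; apply: measurable_funX; apply: measurable_funB => //.
      by apply: mb; exact: cp.
    + by apply/measurable_EFinP; exact: (measurable_covector_norm2 mA mdw).
    + move=> x _; rewrite lee_fin; apply: le_trans (covector_norm2_ge dw x).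
      by rewrite /dw /differential !mxE.
have N0 x : 0 <= covector_norm2 g w x by apply: le_trans (covector_norm2_ge w x); exact: sqr_ge0.
have mN := measurable_covector_norm2 mA mw'.
have kN : (k%:E <= \int[vol]_(x in A) (covector_norm2 g w x)%:E)%E.
  apply: le_trans wk _; apply: ge0_le_integral => //.
  - by move=> x _; rewrite lee_fin sqr_ge0.
  - by apply/measurable_EFinP; exact: measurable_funX.
  - exact/measurable_EFinP.
  - by move=> x _; rewrite lee_fin covector_norm2_ge.
have c0 : 0 <= @conformal_constant R m.+1.
  by rewrite divr_ge0// ?mulr_ge0// subr_ge0 ?ler1n// ler_nat ltnW.
have S0 : - (beta ^+ 2 + \sum_j a j ^+ 2) <= 0.
  by rewrite oppr_le0 addr_ge0 ?sqr_ge0// sumr_ge0// => j _; exact: sqr_ge0.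
have mphi2 : measurable_fun A (fun x : borel M => phi x ^+ 2) by exact: measurable_funX.
have := integral_energy_ge mA c0 S0 mN mphi2 N0 (fun x => sqr_ge0 (phi x)) kN phi1.
move=> /le_trans; apply; rewrite le_eqVlt; apply/orP; left; apply/eqP.
by apply: eq_integral => x _; rewrite scalar_curvature_solv.
Qed.

End eigenvalue.

(** * Choice of the exponents *)

Section exponents.
Context {R : realType} {k : nat}.
Variables (beta b : R).

(** Here [n = k.+3], so [beta / k.+2%:R] is the mean over the [n - 1] spatial directions. Shifting
    two of them by [b] and [- b] keeps the sum and adds [2 b^2] to the sum of squares; [n >= 3]
    provides the two indices. *)
Definition exponents (j : 'I_k.+3) : R :=
  if j == 0 then 0 else
  beta / k.+2%:R + b * ((j == 1%N :> nat)%:R - (j == 2%N :> nat)%:R).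

Lemma exponents0 : exponents 0 = 0. Proof. by rewrite /exponents eqxx. Qed.

Lemma sum_exponents : \sum_j exponents j = beta.
Proof.
rewrite !big_ord_recl exponents0 /exponents /=.
under eq_bigr do rewrite /= subrr mulr0 addr0.
rewrite sumr_const card_ord -mulr_natr.
have : k.+2%:R != 0 :> R by rewrite pnatr_eq0.
by rewrite -[k.+2]addn2 natrD => k0; field.
Qed.

Lemma sum_sqr_exponents : \sum_j exponents j ^+ 2 = beta ^+ 2 / k.+2%:R + 2 * b ^+ 2.
Proof.
rewrite !big_ord_recl exponents0 /exponents /=.
under eq_bigr do rewrite /= subrr mulr0 addr0.
rewrite sumr_const card_ord -mulr_natr.
have : k.+2%:R != 0 :> R by rewrite pnatr_eq0.
by rewrite -[k.+2]addn2 natrD => k0; field.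
Qed.

End exponents.
Arguments exponents {R k}.

(* The two branches make the scalar curvature [-(n beta^2 / (n-1) + 2 b^2)] equal to
   [-n(n-1)], respectively already below it. *)
Definition anisotropy (R : realType) (n : nat) (beta : R) : R :=
  if n%:R - 1 < beta then 0
  else Num.sqrt ((n%:R * (n%:R - 1) - n%:R * beta ^+ 2 / (n%:R - 1)) / 2).

(** * The volume ratio and the conclusion *)

Section volume_ratio.
Context {R : realType} {m : nat}.
Variable a : 'I_m.+1 -> R.
Hypothesis a0 : a 0 = 0.
Local Notation M := (rV_manifold R m).
Local Notation beta := (\sum_j a j).
Local Notation vol := (solv_volume a).

(** The whole outer box bounds the numerator by [X], and [core] bounds the denominator below by [Y].
    The powers of [rho] cancel; [3 * beta] comes from [r + 2] at the top of the outer box and [-1]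
    at the bottom of the core. *)
Lemma volume_ratio (r : R) : 0 < beta -> 0 < r ->
  (vol ((outer_domain a r : set M) `\` inner_domain a r) / vol (inner_domain a r : set M) <
   (2 ^+ m * expR (3 * beta) / beta * expR (beta * r))%:E)%E.
Proof.
move=> b0 r0.
have rho0 := @well_width_gt0 R m a r r0.
set rho := well_width a r in rho0 *.
have mO : measurable (outer_domain a r : set (borel M)) by exact: measurable_slab.
have oI : open (inner_domain a r).
  by apply: deep_component_open => //; exact: open_slab.
have mI : measurable (inner_domain a r : set (borel M)) by exact: sub_sigma_algebra.
pose X := expR (beta * (r + 2)) / beta * (2 * rho) ^+ m.
pose Y := 2 * expR (- beta) * rho ^+ m.
have X0 : 0 < X by rewrite mulr_gt0 ?divr_gt0 ?expR_gt0// exprn_gt0// mulr_gt0.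
have Y0 : 0 < Y by rewrite mulr_gt0 ?exprn_gt0// mulr_gt0 ?expR_gt0.
have VO : (vol (outer_domain a r : set M) <= X%:E)%E.
  rewrite /X EFinM; have -> := @weighted_slab R m (r + 2) rho beta rho0.
  apply: lee_wpmul2r; first by rewrite lee_fin exprn_ge0// mulr_ge0// ltW.
  by apply: integral_expR_itv => //; rewrite addr_gt0.
have VC : (Y%:E <= vol (core a r : set M))%E.
  rewrite /Y EFinM; have -> := @weighted_slab R m 1 (rho / 2) beta (divr_gt0 rho0 (ltr0Sn _ 1)).
  have -> : 2 * (rho / 2) = rho by field.
  apply: lee_wpmul2r; first by rewrite lee_fin exprn_ge0// ltW.
  exact: le_integral_expR_itv.
have VI : (Y%:E <= vol (inner_domain a r : set M))%E.
  apply: le_trans VC _; apply: le_measure; rewrite ?inE//.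
    exact: measurable_slab.
  exact: core_inner.
have VIO : (vol (inner_domain a r : set M) <= X%:E)%E.
  apply: le_trans VO; apply: le_measure; rewrite ?inE//; exact: deep_component_sub.
have VD : (vol ((outer_domain a r : set M) `\` inner_domain a r) <= X%:E)%E.
  apply: le_trans VO; apply: le_measure; rewrite ?inE//; exact: measurableD.
have D0 := measure_ge0 vol ((outer_domain a r : set (borel M)) `\` inner_domain a r).
have I0 := measure_ge0 vol (inner_domain a r : set (borel M)).
have fI : vol (inner_domain a r : set M) \is a fin_num.
  by rewrite ge0_fin_numE//; exact: le_lt_trans VIO (ltry _).
have fD : vol ((outer_domain a r : set M) `\` inner_domain a r) \is a fin_num.
  by rewrite ge0_fin_numE//; exact: le_lt_trans VD (ltry _).
move: VI VD; rewrite -(fineK fI) -(fineK fD).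
move: (fine _) (fine _) => d v; rewrite !lee_fin => Yv dX.
have v0 : 0 < v by exact: lt_le_trans Yv.
rewrite inver gt_eqF// -EFinM lte_fin ltr_pdivrMr//.
apply: le_lt_trans dX _.
apply: (@lt_le_trans _ _ (2 ^+ m * expR (3 * beta) / beta * expR (beta * r) * Y)); last first.
  by rewrite ler_pM2l// mulr_gt0 ?divr_gt0 ?mulr_gt0 ?expR_gt0// exprn_gt0.
(* The constant is exactly twice what [X / Y] requires, which makes the inequality strict. *)
have -> : 2 ^+ m * expR (3 * beta) / beta * expR (beta * r) * Y = 2 * X.
  rewrite /X /Y (_ : beta * (r + 2) = 3 * beta + beta * r - beta); last by ring.
  by rewrite [(2 * rho) ^+ m]exprMn !expRD; field; rewrite gt_eqF.
by rewrite mulr_natl mulr2n ltrDl.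
Qed.

End volume_ratio.

Theorem proposition3p6 (R : realType) (n : nat) (beta : R)
    (hn : (3 <= n)%N) (hbeta : 0 < beta) :
  exists2 C : R, 0 < C &
  \forall r \near +oo,
  exists (M : manifold R n) (g : metric M)
         (vol : {measure set (borel M) -> \bar R}),
    [/\ riemannian_volume g vol,
        complete_metric g,
        ~ compact [set: M] &
        forall x : M, scalar_curvature g x <= - (n%:R * (n%:R - 1))] /\
    exists Omega1 Omega2 : set M,
      [/\ domain Omega1 /\ metric_bounded g Omega1,
          domain Omega2 /\ metric_bounded g Omega2 &
          Omega1 `<=` Omega2] /\
      [/\ forall x, boundary Omega1 x ->
            dist_to g x (boundary Omega2) = r%:E,
          (vol (Omega2 `\` Omega1) / vol Omega1
             < (C * expR (beta * r))%:E)%E,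
          ((if n%:R - 1 < beta
            then 1 / ((n%:R - 1) * (n%:R - 2)) * beta ^+ 2
            else (n%:R - 1) / (n%:R - 2) * beta ^+ 2
                 - n%:R * (n%:R - 1))%:E
             < first_eigenvalue g vol Omega2)%E &
          Num.sqrt (n%:R * (n%:R - 2)) < beta ->
            (0 < first_eigenvalue g vol Omega2)%E].
Proof.
case: n hn => [|[|[|k]]]// _.
pose b := anisotropy k.+3 beta; pose a := exponents beta b : 'I_k.+3 -> R.
have a0 : a 0 = 0 := exponents0 beta b.
have sa : \sum_j a j = beta := sum_exponents beta b.
pose Q := \sum_j a j ^+ 2.
pose N : R := k.+3%:R.
have N3 : 3 <= N by rewrite ler_nat.
have Nk : k.+2%:R = N - 1 by rewrite /N -[k.+3]addn1 natrD addrK.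
have QE : Q = beta ^+ 2 / (N - 1) + 2 * b ^+ 2 by rewrite -Nk; exact: sum_sqr_exponents.
have N10 : 0 < N - 1 by lra.
have N20 : 0 < N - 2 by lra.
have SE : beta ^+ 2 + Q = if N - 1 < beta then N * beta ^+ 2 / (N - 1) else N * (N - 1).
  rewrite QE /b /anisotropy -/N; case: (ltrP (N - 1) beta) => bN.
    by field; rewrite gt_eqF.
  rewrite sqr_sqrtr; first by field; rewrite gt_eqF.
  rewrite divr_ge0// subr_ge0 ler_pdivrMr// -mulrA ler_wpM2l// -expr2.
  by apply: lerXn2r => //; rewrite nnegrE ltW.
have NS : N * (N - 1) <= beta ^+ 2 + Q.
  rewrite SE; case: (ltrP (N - 1) beta) => // bN.
  rewrite ler_pdivlMr// -mulrA ler_wpM2l// -expr2.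
  by apply: lerXn2r (ltW bN) => //; rewrite nnegrE ltW.
exists (2 ^+ k.+2 * expR (3 * beta) / beta).
  by rewrite divr_gt0// mulr_gt0 ?expR_gt0// exprn_gt0.
near=> r.
have r0 : 0 < r by near: r; exact: nbhs_pinfty_gt.
exists (rV_manifold R k.+2), (solv_metric a), (solv_volume a); split.
  split; [exact: riemannian_volume_solv|exact: complete_solv|exact: rV_not_compact|].
  by move=> x; rewrite scalar_curvature_solv// sa lerN2.
exists (inner_domain a r), (outer_domain a r).
have p0 : 0 < r + 2 by rewrite addr_gt0.
have rho0 := @well_width_gt0 R _ a r r0.
have bO : metric_bounded (solv_metric a) (outer_domain a r : set (rV_manifold R k.+2)).
  exact: slab_bounded.
have sub : inner_domain a r `<=` outer_domain a r by exact: deep_component_sub.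
have in0 : inner_domain a r 0.
  apply: core_inner => //.
  by split=> [|j]; rewrite mxE normr0// divr_gt0.
have oO : open (outer_domain a r) by exact: open_slab.
have ev : ((if N - 1 < beta then 1 / ((N - 1) * (N - 2)) * beta ^+ 2
    else (N - 1) / (N - 2) * beta ^+ 2 - N * (N - 1))%:E <
    first_eigenvalue (solv_metric a) (solv_volume a)
      (outer_domain a r : set (rV_manifold R k.+2)))%E.
  (* Half of the Hardy gain [1 / (4 (r + 2)^2)]: [l] is then strictly below the Hardy constant, and
     a positive excess [c_n * d] remains for the strict bound on the eigenvalue. *)
  pose d : R := (8 * (r + 2) ^+ 2)^-1.
  have d0 : 0 < d by rewrite invr_gt0 mulr_gt0// exprn_gt0.
  pose l : R := beta ^+ 2 / 4 + d.
  have l0 : 0 < l by rewrite addr_gt0// divr_gt0// exprn_gt0.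
  have lh : l < hardy_constant (r + 2) (\sum_j a j).
    rewrite /hardy_constant sa /l ltrD2l.
    have -> : (4 * (r + 2) ^+ 2)^-1 = 2 * d.
      by rewrite /d; field; rewrite gt_eqF.
    by rewrite mulr_natl mulr2n ltrDl.
  have := eigenvalue_ge a0 (well_width a r) (isT : (2 < k.+3)%N) p0 l0 lh.
  apply: lt_le_trans; rewrite lte_fin sa -/Q SE /conformal_constant -/N /l.
  have c0 : 0 < 4 * (N - 1) / (N - 2) * d.
    by apply: mulr_gt0 d0; apply: divr_gt0 N20; exact: mulr_gt0.
  rewrite [_ * (beta ^+ 2 / 4 + d)]mulrDr; case: (ltrP (N - 1) beta) => _.
    have -> : 1 / ((N - 1) * (N - 2)) * beta ^+ 2 =
      4 * (N - 1) / (N - 2) * (beta ^+ 2 / 4) - N * beta ^+ 2 / (N - 1).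
      by field; rewrite !gt_eqF.
    by rewrite ltrD2r ltrDl.
  have -> : (N - 1) / (N - 2) * beta ^+ 2 = 4 * (N - 1) / (N - 2) * (beta ^+ 2 / 4).
    by field; rewrite gt_eqF.
  by rewrite ltrD2r ltrDl.
split.
  split=> //; split.
  - split; first by exists 0.
    + exact: deep_component_open.
    + exact: component_connected.
  - by have [c cb] := bO; exists c => x y /sub xO /sub yO; exact: cb.
  - split; [by exists 0; exact: sub|exact: oO|exact: slab_connected].
  - exact: bO.
split.
- by move=> x; exact: boundary_deep_component.
- by have := volume_ratio a0 (r := r); rewrite sa; apply.
- exact: ev.
(* As [ev] is strict, its left side only has to be nonnegative, which for [beta <= n - 1] amounts to
   [n (n - 2) <= beta^2]. *)
move=> hb; apply: le_lt_trans ev; rewrite lee_fin -/N.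
case: (ltrP (N - 1) beta) => _; first by rewrite mulr_ge0 ?sqr_ge0// divr_ge0// ltW// mulr_gt0.
have b2 : N * (N - 2) <= beta ^+ 2.
  rewrite -(@sqr_sqrtr _ (N * (N - 2))); last by rewrite mulr_ge0 ?ltW//; lra.
  by apply: lerXn2r (ltW hb); rewrite nnegrE ?sqrtr_ge0// ltW.
rewrite subr_ge0 [_ / _ * _]mulrAC ler_pdivlMr// mulrAC [N * _ * _]mulrAC.
rewrite [leRHS]mulrC -mulrA; nra.
Unshelve. all: by end_near. Qed.
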